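(* Let $n\ge 1$, $1<p<\infty$, let $R\subset\mathbb R^{n+1}$ be a parabolic rectangle, and let $0\le\gamma<1$, $\gamma<\alpha<1$, $0<q\le1$ and $q\le r<\infty$. Assume that $f\in \mathrm{PBMO}^+_{\gamma,q}(R)$ and let $\|f\|=\|f\|_{\mathrm{PBMO}^+_{\gamma,q}(R)}$. Then there exist a constant $c_R\in\mathbb R$ and a positive constant $c$, depending only on $n,p,q,r,\gamma,\alpha$, such that \[ \int_{R^{+}(\alpha)}(f-c_{R})_+^r\le c\,\|f\|^{r-q}\int_{R^{+}(\gamma)}(f-c_{R})_+^q \] and \[ \int_{R^{-}(\alpha)}(f-c_{R})_-^r\le c\,\|f\|^{r-q}\int_{R^{-}(\gamma)}(f-c_{R})_-^q . \]
   Context: Points of $\mathbb R^{n+1}$ are written $(x,t)$ with $x\in\mathbb R^n$, $t\in\mathbb R$; $|E|$ is Lebesgue measure, integrals are with respect to $dx\,dt$, and $⨍_E g=\frac1{|E|}\int_E g$ denotes the integral average. Write $g_+=\max\{g,0\}$, $g_-=-\min\{g,0\}$. For $x\in\mathbb R^n$ and $L>0$ let $Q(x,L)=\{y\in\mathbb R^n:|y_i-x_i|\le L,\ i=1,\dots,n\}$. A parabolic rectangle (in the $p$-geometry, $1<p<\infty$ fixed) centered at $(x,t)$ with side length $L>0$ is $R=R(x,t,L)=Q(x,L)\times(t-L^p,t+L^p)$. For $-1<\gamma<1$ its upper and lower parts are $R^+(\gamma)=Q(x,L)\times(t+\gamma L^p,t+L^p)$ and $R^-(\gamma)=Q(x,L)\times(t-L^p,t-\gamma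 L^p)$. For a parabolic rectangle $R$, $0\le\gamma<1$ and $0<q<\infty$, a function $f\in L^q_{\mathrm{loc}}(R)$ belongs to $\mathrm{PBMO}^+_{\gamma,q}(R)$ if \[ \|f\|_{\mathrm{PBMO}^+_{\gamma,q}(R)}=\sup_{P\subset R}\ \inf_{c\in\mathbb R}\Big(⨍_{P^+(\gamma)}(f-c)_+^q+⨍_{P^-(\gamma)}(f-c)_-^q\Big)^{1/q}<\infty, \] where the supremum is over all parabolic rectangles $P\subset R$ (including $R$ itself). *)

(* Defs.v *)
From HB Require Import structures.
From mathcomp Require Import all_boot all_order all_algebra.
From mathcomp Require Import all_classical all_reals all_analysis.

Set Implicit Arguments.
Unset Strict Implicit.
Unset Printing Implicit Defensive.

Import Order.TTheory GRing.Theory Num.Theory.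
Import numFieldNormedType.Exports.

Local Open Scope classical_set_scope.
Local Open Scope ring_scope.

(* Lebesgue measure on R^n, realized on n-tuples by iterating the product with
   the one-dimensional Lebesgue measure: R x R^n is identified with R^(n+1)
   through (a, v) |-> a :: v. *)
Section cons_measure.
Context (R : realType) (n : nat).
Local Notation bR := (measurableTypeR R).
Variable m : {sigma_finite_measure set (n.-tuple bR) -> \bar R}.

Definition cons_pair (z : bR * n.-tuple bR) : n.+1.-tuple bR :=
  [tuple of z.1 :: z.2].

Definition uncons_pair (v : n.+1.-tuple bR) : bR * n.-tuple bR :=
  (thead v, [tuple of behead v]).

Lemma cons_pairK : cancel cons_pair uncons_pair.
Proof.
by case=> a v; rewrite /uncons_pair theadE; congr pair; apply/val_inj.
Qed.

Lemma measurable_cons_pair : measurable_fun setT cons_pair.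
Proof.
by apply: measurable_cons; [exact: measurable_fst|exact: measurable_snd].
Qed.

Lemma measurable_uncons_pair : measurable_fun setT uncons_pair.
Proof.
apply: measurable_fun_pair; first exact: measurable_tnth.
exact: measurable_behead.
Qed.

Definition cons_measure : set (n.+1.-tuple bR) -> \bar R :=
  pushforward (@lebesgue_measure R \x m)%E cons_pair.

Let cons_measure0 : cons_measure set0 = 0%E.
Proof. by rewrite /cons_measure /pushforward preimage_set0 measure0. Qed.

Let cons_measure_ge0 A : (0 <= cons_measure A)%E.
Proof. by apply: integral_ge0 => x _; exact: measure_ge0. Qed.

Let cons_measure_sigma_additive : semi_sigma_additive cons_measure.
Proof.
pose P : {measure set _ -> \bar R} := (@lebesgue_measure R \x m)%E.
move=> F mF tF mUF.
rewrite /cons_measure /pushforward preimage_bigcup.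
apply: (@measure_semi_sigma_additive _ _ _ P (fun k => cons_pair @^-1` F k)).
- by move=> k; rewrite -[X in measurable X]setTI; exact: measurable_cons_pair.
- apply/trivIsetP => /= i j _ _ ij; rewrite -preimage_setI.
  by move/trivIsetP : tF => /(_ _ _ _ _ ij) ->//; rewrite preimage_set0.
- rewrite -preimage_bigcup -[X in measurable X]setTI.
  exact: measurable_cons_pair.
Qed.

HB.instance Definition _ := isMeasure.Build _ _ _ cons_measure
  cons_measure0 cons_measure_ge0 cons_measure_sigma_additive.

Let cons_measure_sigma_finite : sigma_finite setT cons_measure.
Proof.
have /sigma_finiteP[F [TF ndF Foo]] := sigma_finiteT (@lebesgue_measure R).
have /sigma_finiteP[G [TG ndG Goo]] := sigma_finiteT m.
exists (fun k => uncons_pair @^-1` (F k `*` G k)).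
  rewrite -preimage_bigcup -[RHS](_ : uncons_pair @^-1` setT = _)//.
  congr (_ @^-1` _); rewrite -setXTT TF TG predeqE => -[x y]; split.
    move=> [/= [i _ Fix] [j _ Gjy]]; exists (maxn i j) => //; split => /=.
      by move: Fix; exact/subsetPset/ndF/leq_maxl.
    by move: Gjy; exact/subsetPset/ndG/leq_maxr.
  by move=> [i _ [/= Fix Giy]]; split; exists i.
move=> k; have [mF Fk] := Foo k; have [mG Gk] := Goo k; split.
  rewrite -[X in measurable X]setTI; apply: measurable_uncons_pair => //.
  exact: measurableX.
rewrite /cons_measure /pushforward -comp_preimage.
rewrite (_ : uncons_pair \o cons_pair = id); last exact/funext/cons_pairK.
rewrite preimage_id product_measure1E// lte_mul_pinfty// ge0_fin_numE//.
Qed.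

HB.instance Definition _ := Measure_isSigmaFinite.Build _ _ _ cons_measure
  cons_measure_sigma_finite.

End cons_measure.

Section lebesgue_spacetime.
Variable R : realType.
Local Notation bR := (measurableTypeR R).

Fixpoint lebesgue_tuple (n : nat) :
    {sigma_finite_measure set (n.-tuple bR) -> \bar R} :=
  match n with
  | 0 => @dirac _ (0.-tuple bR) [tuple] R
  | n'.+1 => cons_measure (lebesgue_tuple n')
  end.

Definition borel_lebesgue (n : nat) :
    {measure set (n.-tuple bR * bR)%type -> \bar R} :=
  (lebesgue_tuple n \x @lebesgue_measure R)%E.

(* R^n x R equipped with the sigma-algebra of all Lebesgue measurable sets,
   i.e. the Caratheodory completion of the product Borel sigma-algebra. *)
Definition spacetime (n : nat) := caratheodory_type (borel_lebesgue n)^*%mu.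

HB.instance Definition _ n := Measurable.on (spacetime n).

Definition lebesgue (n : nat) : {measure set (spacetime n) -> \bar R} :=
  @completed_measure_extension _ _ _ (borel_lebesgue n).

End lebesgue_spacetime.

Section parabolic.
Variables (R : realType) (n : nat).
Implicit Types (x y : n.-tuple R) (t s L l p gamma q c : R).
Implicit Types (D E : set (spacetime R n)) (f : spacetime R n -> R).

Definition cube x L : set (n.-tuple R) :=
  [set y | forall i : 'I_n, `|tnth y i - tnth x i| <= L].

Definition prect p x t L : set (spacetime R n) :=
  cube x L `*` `]t - L `^ p, t + L `^ p[.

Definition prect_up p gamma x t L : set (spacetime R n) :=
  cube x L `*` `]t + gamma * L `^ p, t + L `^ p[.

Definition prect_lo p gamma x t L : set (spacetime R n) :=
  cube x L `*` `]t - L `^ p, t - gamma * L `^ p[.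

(* The tuple type carries no topology; compactness in R^n x R is that of
   'rV[R]_n * R. *)
Definition vec (z : spacetime R n) : 'rV[R]_n * R :=
  (\row_i tnth z.1 i, z.2).

Definition Lq_loc q D f : Prop :=
  measurable_fun D f /\
  forall K : set (spacetime R n), K `<=` D -> compact (vec @` K) ->
    (\int[lebesgue R n]_(z in K) (`|f z| `^ q)%:E < +oo)%E.

Definition avg E (g : spacetime R n -> R) : \bar R :=
  ((fine (lebesgue R n E))^-1%:E * \int[lebesgue R n]_(z in E) (g z)%:E)%E.

(* The value may be +oo; for 0 < q the outer power is then +oo as well. *)
Definition osc p gamma q x t L f c : \bar R :=
  ((avg (prect_up p gamma x t L) (fun z => ((f \- cst c)^\+ z) `^ q)%R
    + avg (prect_lo p gamma x t L) (fun z => ((f \- cst c)^\- z) `^ q)%R)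
   `^ q^-1)%E.

(* A parabolic rectangle is always given by its center and its side length; f is
   a total function of which only the restriction to the rectangle matters. *)
Definition pbmo_norm p gamma q x t L f : \bar R :=
  ereal_sup [set w | exists y s l, [/\ 0 < l,
    prect p y s l `<=` prect p x t L &
    w = ereal_inf (range (osc p gamma q y s l f))]].

Definition pbmo p gamma q x t L f : Prop :=
  Lq_loc q (prect p x t L) f /\ (pbmo_norm p gamma q x t L f < +oo)%E.

End parabolic.

(* Main.v *)
Require Import Defs.
From HB Require Import structures.
From mathcomp Require Import all_boot all_order all_algebra.
From mathcomp Require Import all_classical all_reals all_analysis.
From mathcomp Require Import measurable_realfun.
From mathcomp Require Import ring lra.

Set Implicit Arguments.
Unset Strict Implicit.
Unset Printing Implicit Defensive.

Import Order.TTheory GRing.Theory Num.Theory.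
Import numFieldNormedType.Exports.

Local Open Scope classical_set_scope.
Local Open Scope ring_scope.

(* Stopping-time argument on a grid adapted to the parabolic geometry.  Cells are
   boxes of side ~ L M^-k and duration comparable to side^p; to each cell D is
   attached an earlier cell D^- of the grid (its shift back in time) such that D lies
   in the upper part and D^- in the lower part of one parabolic rectangle P.  A cell
   is bad at level lam if g > lam on more than half of D^-.  If D is not bad, the
   oscillation bound on P^- forces c_P <= lam + C N, and the bound on P^+ then
   controls {g > lam + C N} near D; hence almost every point with g > lam + C N lies
   in the union E_lam of the bad cells.  If M is large, D'^- lies in P^+ for every
   cell D' contained in a child of D, so applying this to the parents of the maximal
   bad cells gives |E_(lam + K N)| <= theta |E_lam|, with theta as small as one likes
   for K large.  Summing over the levels lam = j K N, with theta = 2^-r / 2, gives the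
   integral inequality.  Replacing f by -f and reversing time gives the second one. *)

(** * Stopping times on nested cells *)

(** For the first inequality, the oscillation bound controls [f] from above only on the later half
    of a rectangle and from below only on the earlier half. Hence a value of [c_P] can be bounded
    only by looking back in time, and badness of D is read on D^- instead of D. This has two costs.
    Disjoint bad cells of different generations may have overlapping shifted cells, so disjointness
    must be recovered by a covering selection among the D^-. Moreover the shifted cells leave
    R^+(alpha); the gap alpha - gamma, against a large M, keeps them in R^+(gamma). The weak-type
    bound at height k N is k^-q, whatever N is, so K can be fixed before [f]. N has to exceed the
    norm strictly, since the infimum over c need not be attained; N = 2 ||f|| serves unless the norm
    is 0, a case with its own argument. [c_R] is a nearly optimal constant of R itself, the same for
    both inequalities. It enters the stopping argument through the cells of generation 0, which it
    makes good from level K N on. The ratio theta beats the growth of the r-th powers of the levels,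
    since (j + 3)^r <= 3^r 2^(r j). *)

Lemma measure_bigcup_le d (T : measurableType d) (R : realType)
    (mu : {measure set T -> \bar R}) (J : countType) (V W : J -> set T) (C : R) :
  0 <= C -> (forall j, measurable (V j)) -> (forall j, measurable (W j)) ->
  trivIset setT W -> (forall j, (mu (V j) <= C%:E * mu (W j))%E) ->
  (mu (\bigcup_j V j) <= C%:E * mu (\bigcup_j W j))%E.
Proof.
move=> C0 mV mW tW VW.
pose ext (F : J -> set T) (n : nat) : set T :=
  if pickle_inv n is Some j then F j else set0.
have mext F n : (forall j, measurable (F j)) -> measurable (ext F n).
  by move=> mF; rewrite /ext; case: (pickle_inv n).
have bext F : \bigcup_j F j = \bigcup_n ext F n.
  apply/seteqP; split=> [z [j _ Fj]|z [n _]].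
    by exists (pickle j) => //; rewrite /ext pickleK_inv.
  by rewrite /ext; case: (pickle_inv n) => // j Fj; exists j.
have tWe : trivIset setT (ext W).
  move=> m n _ _; rewrite /ext; move: (@pickle_invK J m) (@pickle_invK J n).
  case: (pickle_inv m) => [i|]; last by move=> _ _ [? []].
  case: (pickle_inv n) => [j|]; last by move=> _ _ [? []].
  by move=> /= <- <- /(tW _ _ I I) ->.
rewrite !bext (measure_semi_bigcup mu (fun n => mext W n mW) tWe); last first.
  by apply: bigcupT_measurable => n; exact: mext.
rewrite -nneseriesZl//.
apply: (@le_trans _ _ (\sum_(0 <= n <oo) mu (ext V n))%E).
  apply: measure_sigma_subadditive => //.
  - by move=> n; exact: mext.
  - by apply: bigcupT_measurable => n; exact: mext.
apply: lee_nneseries => // n _; rewrite /ext.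
by case: (pickle_inv n) => // ; rewrite !measure0 mule0.
Qed.

Lemma measurable_superlevel d (T : measurableType d) (R : realType) (A : set T)
    (h : T -> R) (v : R) : measurable A -> measurable_fun A h ->
  measurable (A `&` [set z | v < h z]).
Proof.
move=> mA mh; have := mh mA _ (measurable_itv `]v, +oo[).
by congr measurable; congr (_ `&` _); apply/seteqP; split=> z /=; rewrite in_itv/= andbT.
Qed.

Lemma measurable_affine d (T : measurableType d) (R : realType) (A : set T)
    (h : T -> R) (e c : R) :
  measurable_fun A h -> measurable_fun A (fun z => e * (h z - c)).
Proof.
move=> mh; apply: measurable_funM; first exact: measurable_cst.
by apply: measurable_funB => //; exact: measurable_cst.
Qed.

Lemma measure0_bigcup d (T : measurableType d) (R : realType)
    (mu : {measure set T -> \bar R}) (J : countType) (V : J -> set T) :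
  (forall j, measurable (V j)) -> (forall j, mu (V j) = 0%E) ->
  mu (\bigcup_j V j) = 0%E.
Proof.
move=> mV V0; apply/eqP; rewrite eq_le measure_ge0 andbT.
have -> : (0 = 1%:E * mu (\bigcup_(j : J) set0))%E.
  by rewrite bigcup0// measure0 mule0.
apply: measure_bigcup_le => //.
- by move=> i j _ _ [? []].
- by move=> j; rewrite V0 mule_ge0.
Qed.

Lemma countable_bigcup_measurable d (T : measurableType d) (J : countType)
    (V : J -> set T) :
  (forall j, measurable (V j)) -> measurable (\bigcup_j V j).
Proof.
move=> mV; apply: countable_bigcupT_measurable => //; exact: countableP.
Qed.

Section core.
Context d (X : measurableType d) (R : realType).
Variable mu : {measure set X -> \bar R}.
Variables (I : countType) (idx : nat -> X -> I).
Hypothesis idxS : forall k z z', idx k.+1 z = idx k.+1 z' -> idx k z = idx k z'.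

(** A grid is given by its labels: the cells of a generation are fibres of [idx k], so they
    partition the space by construction, and [idxS] is their nesting. A label that is not taken has
    an empty cell. *)
Definition cell k i : set X := [set z | idx k z = i].
Hypothesis mcell : forall k i, measurable (cell k i).

Lemma idx_le j k z z' : (j <= k)%N -> idx k z = idx k z' -> idx j z = idx j z'.
Proof.
move=> jk; rewrite -(subnK jk); elim: (k - j)%N => //= m IH.
by rewrite addSn => /idxS.
Qed.

Lemma cell_sub j k i i' : (j <= k)%N -> cell k i `&` cell j i' !=set0 ->
  cell k i `<=` cell j i'.
Proof.
by move=> jk [z [/= zi zi']] w /= wi; rewrite -zi'; apply: (idx_le jk); rewrite wi.
Qed.

(** These are the unions of cells of generation k. There are countably many labels, so such a union
    is measurable without further assumption. *)
Definition saturated k (S : set X) := forall z z', idx k z = idx k z' -> S z -> S z'.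

Lemma saturatedE k S : saturated k S ->
  S = \bigcup_i (if `[< cell k i `<=` S >] then cell k i else set0).
Proof.
move=> Ssat; apply/seteqP; split=> [z Sz|z [i _]].
  exists (idx k z) => //; case: asboolP => // ns.
  by exfalso; apply: ns => w /= wz; apply: Ssat Sz.
by case: asboolP => // + zi; apply.
Qed.

Lemma measurable_saturated k S : saturated k S -> measurable S.
Proof.
move=> /saturatedE ->; apply: countable_bigcup_measurable => i.
by case: asboolP.
Qed.

Lemma saturated_le (A S : set X) k theta : 0 <= theta -> measurable A ->
  (forall i, (mu (A `&` cell k i) <= theta%:E * mu (cell k i))%E) ->
  saturated k S -> (mu (A `&` S) <= theta%:E * mu S)%E.
Proof.
move=> t0 mA Ac Ssat.
pose W i := if `[< cell k i `<=` S >] then cell k i else set0.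
have mW i : measurable (W i) by rewrite /W; case: asboolP.
have -> : A `&` S = \bigcup_i (A `&` W i).
  by rewrite -setI_bigcupr -saturatedE.
rewrite [in leRHS](saturatedE Ssat).
apply: measure_bigcup_le => //.
- by move=> i; exact: measurableI.
- move=> i j _ _; rewrite /W; case: asboolP => _; last by case=> ? [].
  case: asboolP => _; last by case=> ? [].
  by case=> z [/= <- <-].
- move=> i; rewrite /W; case: asboolP => // _.
  by rewrite setI0 !measure0 mule0.
Qed.

(* Plays the role of the Lebesgue differentiation theorem: a null set results from
   approximating A in measure by a union of cells of one generation. *)
Lemma density (Om A : set X) theta : 0 <= theta -> theta < 1 -> measurable A ->
  A `<=` Om -> (mu Om < +oo)%E -> measurable Om ->
  (forall B, measurable B -> B `<=` Om -> forall e, 0 < e ->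
     exists k S, [/\ saturated k S, S `<=` Om, (mu (B `\` S) <= e%:E)%E &
       (mu (S `\` B) <= e%:E)%E]) ->
  (forall k i, (mu (A `&` cell k i) <= theta%:E * mu (cell k i))%E) ->
  mu A = 0%E.
Proof.
move=> t0 t1 mA AO Ofin mO approx Ac.
have Afin : mu A \is a fin_num.
  by rewrite ge0_fin_numE//; apply: le_lt_trans Ofin; apply: le_measure; rewrite ?inE.
have key e : 0 < e -> (mu A <= theta%:E * (mu A + e%:E) + e%:E)%E.
  move=> e0; have [k [S [Ssat SO AS SA]]] := approx _ mA AO _ e0.
  have mS := measurable_saturated Ssat.
  rewrite [in leLHS](measureDI mu mA mS) [leLHS]addeC leeD//.
  apply: (le_trans (saturated_le t0 mA (Ac k) Ssat)).
  rewrite lee_wpmul2l ?lee_fin//.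
  rewrite [in leLHS](measureDI mu mS mA) [leLHS]addeC leeD//.
  by apply: le_measure; rewrite ?inE//; exact: measurableI.
move: key; rewrite -(fineK Afin); set a := fine _ => key.
have a0 : 0 <= a by exact: fine_ge0.
congr EFin; apply/eqP; rewrite eq_le a0 andbT; apply/ler_addgt0Pr => e e0.
(* With e' in place of e, [key] reads (1 - theta) a <= (1 + theta) e', which is at most 2 e' = e (1
   - theta). *)
have e'0 : 0 < e * (1 - theta) / 2.
  by rewrite divr_gt0// mulr_gt0// subr_gt0.
have := key _ e'0; rewrite -!(EFinD, EFinM) lee_fin => H.
have : a * (1 - theta) <= e * (1 - theta) by nra.
by rewrite add0r ler_pM2r// subr_gt0.
Qed.

(* [cell k (sh k i)] is the cell D^- attached to D = [cell k i], [Pp k i] the upper part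
   of the rectangle containing both, and [G lam] the superlevel set at lam. *)
Variables (sh : nat -> I -> I) (Dil : nat -> I -> set X) (G : R -> set X)
  (Pp : nat -> I -> set X) (Om U : set X) (b eta C1 C4 : R).
Hypothesis sh_inj : forall k, injective (sh k).
Hypothesis mDil : forall k i, measurable (Dil k i).
Hypothesis mPp : forall k i, measurable (Pp k i).
Hypothesis mG : forall lam, measurable (G lam).
Hypothesis G_anti : forall l l', l <= l' -> G l' `<=` G l.
Hypothesis mU : measurable U.
Hypothesis Omsat : saturated 0 Om.
Hypothesis (b_ge0 : 0 <= b) (eta_ge0 : 0 <= eta) (eta_lt1 : eta < 1)
  (C1_ge0 : 0 <= C1) (C4_ge0 : 0 <= C4).
Hypothesis muDil : forall k i, (mu (Dil k i) <= C1%:E * mu (cell k (sh k i)))%E.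
Hypothesis cell_Dil : forall k k' i i', (k <= k')%N ->
  cell k' (sh k' i') `&` cell k (sh k i) !=set0 -> cell k' i' `<=` Dil k i.

Definition bad k i lam :=
  ((2^-1)%:E * mu (cell k (sh k i)) < mu (cell k (sh k i) `&` G lam))%E.

Hypothesis osc_good : forall k z lam, Om z -> ~ bad k (idx k z) lam ->
  (mu (Pp k (idx k z) `&` G (lam + b)) <= eta%:E * mu (cell k (idx k z)))%E.
Hypothesis cell_Pp : forall k i, cell k i `<=` Pp k i.
Hypothesis shift_Pp : forall k k' z, (k < k')%N ->
  cell k' (sh k' (idx k' z)) `<=` Pp k (idx k z).
Hypothesis mu_parent : forall k z,
  (mu (cell k (idx k z)) <= C4%:E * mu (cell k.+1 (idx k.+1 z)))%E.
Hypothesis shift_U : forall k z, Om z -> cell k (sh k (idx k z)) `<=` U.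

Definition excess lam := [set z | Om z /\ exists k, bad k (idx k z) lam].

Lemma bad_anti k i l l' : l <= l' -> bad k i l' -> bad k i l.
Proof.
move=> ll' /lt_le_trans; apply; apply: le_measure; rewrite ?inE.
- exact: measurableI.
- exact: measurableI.
- by apply: setIS; exact: G_anti.
Qed.

Let mOm : measurable Om. Proof. exact: measurable_saturated Omsat. Qed.

Lemma measurable_excess lam : measurable (excess lam).
Proof.
have -> : excess lam = Om `&` \bigcup_(ki : nat * I)
    (if `[< bad ki.1 ki.2 lam >] then cell ki.1 ki.2 else set0).
  apply/seteqP; split=> [z [Oz [k kz]]|z [Oz [[k i] _]]] /=.
    by split=> //; exists (k, idx k z) => //=; case: asboolP.
  by case: asboolP => // ki zi; split=> //; exists k; rewrite zi.
apply: measurableI => //; apply: countable_bigcup_measurable => -[k i] /=.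
by case: asboolP.
Qed.

Lemma excess_anti l l' : l <= l' -> excess l' `<=` excess l.
Proof.
by move=> ll' z [Oz [k kz]]; split=> //; exists k; exact: bad_anti kz.
Qed.

(* Among the shifted cells of the family, those of minimal generation are disjoint and
   contain all the others; the corresponding dilates cover the unshifted cells. *)
Lemma select (F : nat -> I -> Prop) (B : set X) lam : measurable B ->
  (forall k i, F k i -> bad k i lam) ->
  (forall k i, F k i -> cell k (sh k i) `<=` B) ->
  (mu (\bigcup_(ki in [set ki : nat * I | F ki.1 ki.2]) cell ki.1 ki.2)
     <= (2 * C1)%:E * mu (B `&` G lam))%E.
Proof.
move=> mB Fbad FB.
pose F' k i := F k i /\ forall k' i', (k' < k)%N -> F k' i' ->
  ~ (cell k (sh k i) `&` cell k' (sh k' i') !=set0).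
pose V (ki : nat * I) := if `[< F' ki.1 ki.2 >] then Dil ki.1 ki.2 else set0.
pose W (ki : nat * I) :=
  if `[< F' ki.1 ki.2 >] then cell ki.1 (sh ki.1 ki.2) `&` G lam else set0.
have mV ki : measurable (V ki) by rewrite /V; case: asboolP.
have mW ki : measurable (W ki).
  by rewrite /W; case: asboolP => // _; exact: measurableI.
(* The strict inequality in [bad] forces positive measure. So each shifted cell of the family meets
   itself, which starts the search for a minimal generation. *)
have nonempty k i : F k i -> cell k (sh k i) !=set0.
  move=> /Fbad; rewrite /bad; have [->|/set0P//] := eqVneq (cell k (sh k i)) set0.
  by rewrite set0I measure0 mule0 ltxx.
apply: (@le_trans _ _ (mu (\bigcup_ki V ki))).
  apply: le_measure; rewrite ?inE.
  - rewrite (_ : \bigcup_(_ in _) _ = \bigcup_ki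
      (if `[< F ki.1 ki.2 >] then cell ki.1 ki.2 else set0)).
      by apply: countable_bigcup_measurable => -[k i] /=; case: asboolP.
    apply/seteqP; split=> z [ki].
      by move=> Fki ?; exists ki => //; case: asboolP.
    by move=> _; case: asboolP => // Fki zi; exists ki.
  - exact: countable_bigcup_measurable.
  - move=> z [[k i] /= Fki zi].
    have ex : exists k' : nat, `[< exists i', [/\ F k' i', (k' <= k)%N &
        cell k (sh k i) `&` cell k' (sh k' i') !=set0] >].
      exists k; apply/asboolP; exists i; split => //.
      by rewrite setIid; exact: nonempty.
    case: (ex_minnP ex) => k' /asboolP[i' [Fk'i' k'k meet]] mini.
    exists (k', i') => //; rewrite /V/=; case: asboolP => [_|].
      exact: (cell_Dil k'k meet).
    (* A shifted cell of an earlier generation that meets the chosen one contains it by nesting,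
       hence also meets the original one. This contradicts the minimality of [k']. *)
    case; split=> // k'' i'' k''k' Fk''i'' meet'.
    suff : (k' <= k'')%N by rewrite leqNgt k''k'.
    apply: mini; apply/asboolP.
    exists i''; split => //; first by rewrite (leq_trans _ k'k)// ltnW.
    case: meet => w [wi wi']; exists w; split => //.
    by apply: (cell_sub (ltnW k''k') meet').
apply: (@le_trans _ _ ((2 * C1)%:E * mu (\bigcup_ki W ki))%E).
  apply: measure_bigcup_le => //.
  - by rewrite mulr_ge0.
  - move=> [k i] [k' i'] _ _; rewrite /W/=.
    case: asboolP => [[Fki mki]|]; last by move=> _ [? []].
    case: asboolP => [[Fki' mki']|]; last by move=> _ [? []].
    move=> [z [[zi _] [zi' _]]].
    have [kk'|kk'|kk'] := ltngtP k k'.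
    + by exfalso; apply: (mki' _ _ kk' Fki); exists z.
    + by exfalso; apply: (mki _ _ kk' Fki'); exists z.
    + subst k'; congr pair; apply: (@sh_inj k).
      by move: zi zi'; rewrite /cell/= => <- <-.
  - move=> [k i]; rewrite /V /W/=; case: asboolP; last first.
      by rewrite !measure0 mule0.
    move=> [/Fbad]; rewrite /bad => Hb _.
    apply: (le_trans (muDil k i)).
    rewrite mulrC EFinM -muleA lee_wpmul2l ?lee_fin//.
    have -> : mu (cell k (sh k i)) = (2%:E * ((2^-1)%:E * mu (cell k (sh k i))))%E.
      by rewrite muleA -EFinM divff// mul1e.
    by rewrite lee_wpmul2l ?lee_fin// ltW.
rewrite lee_wpmul2l ?lee_fin ?mulr_ge0//.
apply: le_measure; rewrite ?inE.
- exact: countable_bigcup_measurable.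
- exact: measurableI.
- move=> z [[k i] _]; rewrite /W/=; case: asboolP => // -[/FB + _] [zi Gz].
  by move=> /(_ _ zi).
Qed.

(** Start of the iteration. The bound is by a level set within [U] and not by the measure of [U];
    Chebyshev's inequality will later convert it into the integral on the right-hand side of the
    theorem. *)
Lemma excess_init lam : (mu (excess lam) <= (2 * C1)%:E * mu (U `&` G lam))%E.
Proof.
pose F k i := (exists2 z, Om z & idx k z = i) /\ bad k i lam.
apply: le_trans (@select F U lam mU _ _); last 2 first.
- by move=> k i [].
- by move=> k i [[z Oz <-] _]; exact: shift_U.
apply: le_measure; rewrite ?inE; first exact: measurable_excess.
- rewrite (_ : \bigcup_(_ in _) _ = \bigcup_ki
      (if `[< F ki.1 ki.2 >] then cell ki.1 ki.2 else set0)).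
    by apply: countable_bigcup_measurable => -[k i] /=; case: asboolP.
  apply/seteqP; split=> z [ki].
    by move=> Fki ?; exists ki => //; case: asboolP.
  by move=> _; case: asboolP => // Fki zi; exists ki.
- by move=> z [Oz [k kz]]; exists (k, idx k z) => //=; split=> //; exists z.
Qed.

(** No cell of generation 0 is bad, so each maximal bad cell has a parent, and this parent is good.
    Through [shift_Pp] the shifted cells met below the parent lie in one set [Pp], where [osc_good]
    makes the level set small: [eta] comes from this, [C4] from the passage from parent to child,
    and [2 * C1] from [select]. *)
Lemma excess_decay lam : (forall z, Om z -> ~ bad 0 (idx 0 z) lam) ->
  (mu (excess (lam + b)) <= (2 * C1 * eta * C4)%:E * mu (excess lam))%E.
Proof.
move=> top.
pose F' k i := [/\ exists2 z, Om z & idx k z = i, bad k i lam &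
  forall k' z, (k' < k)%N -> idx k z = i -> ~ bad k' (idx k' z) lam].
pose W (ki : nat * I) := if `[< F' ki.1 ki.2 >] then cell ki.1 ki.2 else set0.
have mW ki : measurable (W ki) by rewrite /W; case: asboolP.
have F'Om k i z : F' k i -> idx k z = i -> Om z.
  move=> [[w Ow wi] _ _] zi; apply: Omsat Ow; apply: (@idx_le 0 k) => //.
  by rewrite wi.
have excE : excess lam = \bigcup_ki W ki.
  apply/seteqP; split=> [z [Oz [k kz]]|z [[k i] _]]; last first.
    rewrite /W/=; case: asboolP => // F'ki zi; split.
      exact: F'Om zi.
    by exists k; rewrite zi; case: F'ki.
  have ex : exists k' : nat, `[< bad k' (idx k' z) lam >].
    by exists k; exact/asboolP.
  case: (ex_minnP ex) => k' /asboolP k'z mini.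
  exists (k', idx k' z) => //; rewrite /W/=; case: asboolP => //; case; split => //.
    by exists z.
  move=> k'' w k''k' wz; rewrite (idx_le (ltnW k''k') wz) => /asboolP/mini.
  by rewrite leqNgt k''k'.
have bb : lam <= lam + b by rewrite lerDl.
rewrite -(setIidr (excess_anti bb)) excE setI_bigcupl.
apply: measure_bigcup_le => //.
- by rewrite !mulr_ge0.
- by move=> ki; apply: measurableI => //; exact: measurable_excess.
- move=> [k i] [k' i'] _ _; rewrite /W/=.
  case: asboolP => [Fki|]; last by move=> _ [? []].
  case: asboolP => [Fki'|]; last by move=> _ [? []].
  move=> [z [zi zi']].
  have [kk'|kk'|kk'] := ltngtP k k'.
  + exfalso; case: Fki' => _ _ /(_ _ _ kk' zi'); rewrite zi; apply.
    by case: Fki.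
  + exfalso; case: Fki => _ _ /(_ _ _ kk' zi); rewrite zi'; apply.
    by case: Fki'.
  + by subst k'; rewrite -zi -zi'.
move=> [k i]; rewrite /W/=; case: asboolP => [F'ki|]; last first.
  by rewrite set0I !measure0 mule0.
case: k F'ki => [|k] F'ki.
  exfalso; case: (F'ki) => -[z Oz zi] + _.
  by rewrite -zi; exact: top.
case: (F'ki) => -[z0 Oz0 z0i] bki mki.
(* Only generations beyond that of the parent occur: a cell bad at [lam + b] is bad at [lam],
   whereas all proper ancestors of a maximal bad cell are good at [lam]. *)
pose F k' i' := [/\ exists2 z, idx k.+1 z = i & i' = idx k' z,
   (k < k')%N & bad k' i' (lam + b)].
apply: (@le_trans _ _ (mu
   (\bigcup_(ki in [set ki : nat * I | F ki.1 ki.2]) cell ki.1 ki.2))).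
  apply: le_measure; rewrite ?inE.
  - by apply: measurableI => //; exact: measurable_excess.
  - rewrite (_ : \bigcup_(_ in _) _ = \bigcup_ki
        (if `[< F ki.1 ki.2 >] then cell ki.1 ki.2 else set0)).
      by apply: countable_bigcup_measurable => -[? ?] /=; case: asboolP.
    apply/seteqP; split=> z [ki].
      by move=> Fki ?; exists ki => //; case: asboolP.
    by move=> _; case: asboolP => // Fki zi; exists ki.
  - move=> z [zi [Oz [k' k'z]]]; exists (k', idx k' z) => //=; split => //.
      by exists z.
    rewrite ltnNge; apply/negP => k'k.
    by apply: (mki k' z) => //; exact: bad_anti k'z.
apply: le_trans (@select F (Pp k (idx k z0)) (lam + b) (mPp _ _) _ _) _.
- by move=> ? ? [].
- move=> k' _ [[z zi ->] kk' _].
  rewrite (_ : idx k z0 = idx k z); first exact: shift_Pp.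
  by apply: idxS; rewrite z0i.
have -> : 2 * C1 * eta * C4 = (2 * C1) * (eta * C4) by rewrite mulrA.
rewrite [in leRHS]EFinM -muleA lee_wpmul2l ?lee_fin ?mulr_ge0//.
apply: (le_trans (osc_good Oz0 _)).
  by apply: (mki k z0).
rewrite EFinM -muleA lee_wpmul2l ?lee_fin//.
by rewrite -z0i; exact: mu_parent.
Qed.

(** A cell that meets the exceptional set contains a point lying in no bad cell, hence is itself
    good. By [osc_good] the exceptional set then fills at most the fraction [eta] < 1 of every cell,
    and [density] applies. *)
Lemma excess_cover lam : (mu Om < +oo)%E ->
  (forall B, measurable B -> B `<=` Om -> forall e, 0 < e ->
     exists k S, [/\ saturated k S, S `<=` Om, (mu (B `\` S) <= e%:E)%E &
       (mu (S `\` B) <= e%:E)%E]) ->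
  mu ((Om `&` G (lam + b)) `\` excess lam) = 0%E.
Proof.
move=> Ofin approx.
have mA : measurable ((Om `&` G (lam + b)) `\` excess lam).
  by apply: measurableD; [exact: measurableI|exact: measurable_excess].
apply: (@density Om _ eta) => //.
  by move=> z [[]].
move=> k i.
have [->|/set0P[z [[[Oz Gz] nez] zi]]] := eqVneq
    (((Om `&` G (lam + b)) `\` excess lam) `&` cell k i) set0.
  by rewrite measure0 mule_ge0.
have good : ~ bad k (idx k z) lam.
  by move=> kz; apply: nez; split=> //; exists k.
rewrite -zi; apply: le_trans (osc_good Oz good).
apply: le_measure; rewrite ?inE.
- by apply: measurableI.
- by apply: measurableI.
- by move=> w [[[_ Gw] _] wz]; split => //; exact: cell_Pp.
Qed.

End core.

(** * Approximation by unions of cells *)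

Section boxes.
Variable R : realType.
Local Notation bR := (measurableTypeR R).

Definition box n (J : 'I_n -> set bR) : set (n.-tuple bR) :=
  [set v | forall i, J i (tnth v i)].

Lemma measurable_box n (J : 'I_n -> set bR) :
  (forall i, measurable (J i)) -> measurable (box J).
Proof.
move=> mJ.
have -> : box J = \bigcap_(i in [set: 'I_n]) ((@tnth n bR)^~ i @^-1` J i).
  by apply/seteqP; split=> v /= Jv i; [move=> _|]; exact: Jv.
apply: fin_bigcap_measurable => // i _; rewrite -[X in measurable X]setTI.
exact: measurable_tnth.
Qed.

Lemma lebesgue_tuple_box n (J : 'I_n -> set bR) :
  (forall i, measurable (J i)) ->
  lebesgue_tuple R n (box J) = (\prod_(i < n) lebesgue_measure (J i))%E.
Proof.
elim: n J => [J _|n IH J mJ].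
  by rewrite big_ord0 /= diracE mem_set// => -[].
rewrite big_ord_recl/=.
rewrite /cons_measure /pushforward.
rewrite (_ : _ @^-1` _ = J ord0 `*` box (fun i => J (lift ord0 i))).
  rewrite product_measure1E//; first by rewrite IH.
  exact: measurable_box.
apply/seteqP; split=> [[a v] /= Jav|[a v] /= [Ja Jv] i].
  by split=> [|i /=]; [exact: (Jav ord0)|have := Jav (lift ord0 i); rewrite tnthS].
by have [j ->|->//] := unliftP ord0 i; rewrite tnthS; exact: Jv.
Qed.

Lemma borel_measurable n (A : set (n.-tuple bR * bR)) :
  measurable A -> measurable (A : set (spacetime R n)).
Proof. by move=> mA; exact: caratheodory_measurable_mu_ext. Qed.

Lemma lebesgueE n (A : set (n.-tuple bR * bR)) :
  measurable A -> lebesgue R n A = borel_lebesgue R n A.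
Proof. by move=> mA; exact: measurable_mu_extE. Qed.

Lemma lebesgue_boxX n (J : 'I_n -> set bR) (K : set bR) :
  (forall i, measurable (J i)) -> measurable K ->
  lebesgue R n (box J `*` K) =
  ((\prod_(i < n) lebesgue_measure (J i)) * lebesgue_measure K)%E.
Proof.
move=> mJ mK; rewrite lebesgueE; last by apply: measurableX => //; exact: measurable_box.
rewrite -lebesgue_tuple_box//.
by apply: product_measure1E => //; exact: measurable_box.
Qed.

Lemma measurable_boxX n (J : 'I_n -> set bR) (K : set bR) :
  (forall i, measurable (J i)) -> measurable K ->
  measurable (box J `*` K : set (spacetime R n)).
Proof.
by move=> mJ mK; apply: borel_measurable; apply: measurableX => //; exact: measurable_box.
Qed.

End boxes.

Section approximation.
Variables (R : realType) (n : nat) (I : countType).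
Local Notation X := (spacetime R n).
Local Notation mu := (lebesgue R n).
Variable idx : nat -> X -> I.
Hypothesis idxS : forall k z z', idx k.+1 z = idx k.+1 z' -> idx k z = idx k z'.
Hypothesis mcell : forall k i, measurable (cell idx k i).
Variable Om : set X.
Hypothesis Omsat : saturated idx 0 Om.
Hypothesis Omfin : (mu Om < +oo)%E.
Variables (loS : 'I_n -> nat -> I -> R) (loT : nat -> I -> R).
Hypothesis loS_le : forall j k (z : X), loS j k (idx k z) <= tnth z.1 j.
Hypothesis loT_le : forall k (z : X), loT k (idx k z) <= z.2.
Hypothesis loS_lim : forall j (z : X) e, 0 < e ->
  exists k, tnth z.1 j - e < loS j k (idx k z).
Hypothesis loT_lim : forall (z : X) e, 0 < e ->
  exists k, z.2 - e < loT k (idx k z).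

Let mOm : measurable Om. Proof. exact: measurable_saturated Omsat. Qed.

(** [B] is an arbitrary measurable set and only its trace on [Om] is approximated. Complementation
    within [Om] exchanges the two errors, which makes the class stable under complement. *)
Definition approximable : set (set X) := [set B | measurable B /\
  forall e, 0 < e -> exists k S, [/\ saturated idx k S, S `<=` Om,
    (mu (Om `&` B `\` S) <= e%:E)%E & (mu (S `\` B) <= e%:E)%E]].

Lemma saturated_le_lvl k k' S : (k <= k')%N ->
  saturated idx k S -> saturated idx k' S.
Proof. by move=> kk' Ssat z z' zz'; apply: Ssat; exact: (idx_le idxS kk' zz'). Qed.

Lemma approximable_saturated k S : saturated idx k S -> approximable S.
Proof.
move=> Ssat; split; first exact: (measurable_saturated mcell Ssat).
move=> e e0; exists k, (Om `&` S); split.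
- move=> z z' zz' [Oz Sz]; split; last exact: Ssat Sz.
  exact: (saturated_le_lvl (leq0n k) Omsat zz').
- by move=> z [].
- by rewrite setDv measure0 lee_fin ltW.
- by rewrite -setIDA setDv setI0 measure0 lee_fin ltW.
Qed.

Lemma approximableC B : approximable B -> approximable (~` B).
Proof.
move=> [mB aB]; split; first exact: measurableC.
move=> e e0; have [k [S [Ssat SO BS SB]]] := aB _ e0.
exists k, (Om `\` S); split.
- move=> z z' zz' [Oz Sz]; split.
    exact: (saturated_le_lvl (leq0n k) Omsat zz').
  by move=> Sz'; apply: Sz; apply: Ssat Sz'.
- by move=> z [].
- rewrite (_ : _ `\` _ = S `\` B)//; apply/seteqP; split=> z /=.
    by move=> [[Oz Bz] /not_andP[//|/contrapT]].
  by move=> [Sz Bz]; split; [split => //; exact: SO|case].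
- rewrite (_ : (Om `\` S) `\` ~` B = Om `&` B `\` S)//; apply/seteqP; split=> z /=.
    by move=> [[Oz Sz] /contrapT Bz].
  by move=> [[Oz Bz] Sz]; split.
Qed.

Lemma approximable0 : approximable set0.
Proof. by apply: (@approximable_saturated 0) => z z'. Qed.

Lemma approximableU A B : approximable A -> approximable B ->
  approximable (A `|` B).
Proof.
move=> [mA aA] [mB aB]; split; first exact: measurableU.
move=> e e0; have e2 : 0 < e / 2 by rewrite divr_gt0.
have [k [S [Ssat SO AS SA]]] := aA _ e2.
have [k' [S' [S'sat S'O BS' S'B]]] := aB _ e2.
have mS := measurable_saturated mcell Ssat.
have mS' := measurable_saturated mcell S'sat.
have ee : (e%:E = (e / 2)%:E + (e / 2)%:E)%E by rewrite -EFinD -splitr.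
exists (maxn k k'), (S `|` S'); split.
- move=> z z' zz' [Sz|Sz]; [left|right].
  + exact: (saturated_le_lvl (leq_maxl k k') Ssat zz').
  + exact: (saturated_le_lvl (leq_maxr k k') S'sat zz').
- by move=> z []; [exact: SO|exact: S'O].
- rewrite ee; apply: le_trans (leeD AS BS').
  apply: le_trans (measureU2 _ _ _).
  + apply: le_measure; rewrite ?inE.
    * by apply: measurableD; [apply: measurableI => //; exact: measurableU|exact: measurableU].
    * by apply: measurableU; (apply: measurableD => //; exact: measurableI).
    * by move=> z [[Oz [Az|Bz]] /not_orP[Sz Sz']]; [left|right].
  + by apply: measurableD => //; exact: measurableI.
  + by apply: measurableD => //; exact: measurableI.
- rewrite ee; apply: le_trans (leeD SA S'B).
  apply: le_trans (measureU2 _ _ _).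
  + apply: le_measure; rewrite ?inE.
    * by apply: measurableD; exact: measurableU.
    * by apply: measurableU; exact: measurableD.
    * by move=> z [[Sz|Sz] /not_orP[Az Bz]]; [left|right].
  + exact: measurableD.
  + exact: measurableD.
Qed.

(** Within [Om], of finite measure, continuity from above makes the part missed by a finite union at
    most e / 2. The finite union is then approximated with error e / 2. *)
Lemma approximable_bigcup (F : nat -> set X) : (forall i, approximable (F i)) ->
  approximable (\bigcup_i F i).
Proof.
move=> aF; pose B m := \big[setU/set0]_(i < m) F i.
have aB m : approximable (B m).
  elim: m => [|m IH]; rewrite /B; first by rewrite big_ord0; exact: approximable0.
  by rewrite big_ord_recr/=; exact: approximableU.
have mF i : measurable (F i) := (aF i).1.
have mB m : measurable (B m) := (aB m).1.
have mU : measurable (\bigcup_i F i) by exact: bigcupT_measurable.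
have BF m : B m `<=` \bigcup_i F i.
  by move=> z; rewrite /B -bigcup_mkord => -[i _ Fi]; exists i.
split=> // e e0; have e2 : 0 < e / 2 by rewrite divr_gt0.
pose Q m := (Om `&` \bigcup_i F i) `\` B m.
have mQ m : measurable (Q m) by apply: measurableD => //; exact: measurableI.
have Q0 : \bigcap_m Q m = set0.
  apply/seteqP; split=> // z Qz; case: (Qz 0%N Logic.I) => [[_ [i _ Fi]] _].
  by case: (Qz i.+1 Logic.I) => _; apply; rewrite /B -bigcup_mkord; exists i => /=.
have : (mu \o Q) m @[m --> \oo] --> mu (\bigcap_m Q m).
  apply: nonincreasing_cvg_mu => //.
  - apply: le_lt_trans Omfin; apply: le_measure; rewrite ?inE//.
    by move=> z [[]].
  - by rewrite Q0.
  - move=> m m' mm'; apply/subsetPset => z [Oz nBz]; split=> // Bz; apply: nBz.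
    move: Bz; rewrite /B -!bigcup_mkord => -[i /= im Fi]; exists i => //=.
    exact: leq_trans mm'.
rewrite Q0 measure0 => Qcvg.
have [m Qm] : exists m, (mu (Q m) <= (e / 2)%:E)%E.
  have /fine_cvgP[Qfin /cvgr_lt/(_ _ e2) Qlt] := Qcvg.
  suff [m _] : \forall m \near \oo, (mu (Q m) <= (e / 2)%:E)%E.
    by move=> /(_ m (leqnn m)); exists m.
  near=> m.
  rewrite -(fineK (_ : mu (Q m) \is a fin_num)); last by near: m.
  by rewrite lee_fin ltW//; near: m.
have [k [S [Ssat SO BS SB]]] := (aB m).2 _ e2.
have mS := measurable_saturated mcell Ssat.
exists k, S; split=> //.
- rewrite [e]splitr EFinD; apply: le_trans (leeD Qm BS).
  apply: le_trans (measureU2 _ _ _).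
  + apply: le_measure; rewrite ?inE.
    * by apply: measurableD => //; exact: measurableI.
    * by apply: measurableU => //; apply: measurableD => //; exact: measurableI.
    * move=> z [[Oz Fz] nS]; have [Bz|Bz] := pselect (B m z); first by right.
      by left.
  + exact: mQ.
  + by apply: measurableD => //; exact: measurableI.
- apply: le_trans (le_trans SB _); last first.
    by rewrite lee_fin; lra.
  apply: le_measure; rewrite ?inE.
  + exact: measurableD.
  + exact: measurableD.
  + by move=> z [Sz nF]; split=> // /BF.
Unshelve. all: by end_near. Qed.

Let T := g_sigma_algebraType approximable.

(** The approximable sets become the measurable sets of a type [T]; that every Borel set is
    approximable reduces to the measurability of the coordinates as functions on [T]. *)
Lemma approximable_sigma : @measurable _ T = approximable.
Proof.
apply/seteqP; split; last exact: sub_sigma_algebra.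
apply: smallest_sub => //; split.
- exact: approximable0.
- by move=> A aA; rewrite setTD; exact: approximableC.
- exact: approximable_bigcup.
Qed.

(** The set where [c] exceeds a is the union over k of the sets where the lower corner [lo k] of the
    cell exceeds a. Each of these is saturated at generation k. *)
Lemma measurable_coordinate (c : X -> R) (lo : nat -> I -> R) :
  (forall k z, lo k (idx k z) <= c z) ->
  (forall z e, 0 < e -> exists k, c z - e < lo k (idx k z)) ->
  measurable_fun [set: T] (c : T -> measurableTypeR R).
Proof.
move=> lo_le lo_lim; apply: (measurability _ (RGenOInfty.measurableE R)).
move=> _ [_ [a ->] <-]; rewrite setTI approximable_sigma.
rewrite (_ : _ @^-1` _ = \bigcup_k [set z | a < lo k (idx k z)]).
  apply: approximable_bigcup => k; apply: (@approximable_saturated k).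
  by move=> z z' /= ->.
apply/seteqP; split=> z /=; rewrite in_itv/= andbT.
  move=> acz; have [|k kz] := lo_lim z (c z - a); first by rewrite subr_gt0.
  by exists k => //=; move: kz; rewrite subKr.
by move=> [k _] /= /lt_le_trans; apply.
Qed.

Lemma borel_approximable (B : set (n.-tuple (measurableTypeR R) * measurableTypeR R)) :
  measurable B -> approximable B.
Proof.
move=> mB; rewrite -approximable_sigma.
have : measurable_fun [set: T] (fun z : T => (z.1, z.2) :
    (n.-tuple (measurableTypeR R) * measurableTypeR R)%type).
  apply: measurable_fun_pair.
    apply/measurable_fun_tnthP => j.
    exact: (measurable_coordinate (loS_le j) (loS_lim j)).
  exact: (measurable_coordinate loT_le loT_lim).
move=> /(_ measurableT _ mB); rewrite setTI.
by rewrite (_ : _ @^-1` _ = B)//; apply/seteqP; split=> -[].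
Qed.

Lemma approximate (A : set X) : measurable A -> A `<=` Om -> forall e, 0 < e ->
  exists k S, [/\ saturated idx k S, S `<=` Om, (mu (A `\` S) <= e%:E)%E &
    (mu (S `\` A) <= e%:E)%E].
Proof.
move=> mA AO e e0; have e2 : 0 < e / 2 by rewrite divr_gt0.
have Afin : mu A \is a fin_num.
  by rewrite ge0_fin_numE//; apply: le_lt_trans Omfin; apply: le_measure; rewrite ?inE.
(* The measure of [A] is by definition an infimum over countable Borel covers. This replaces the
   Lebesgue measurable [A] by a Borel set [B] containing it, at a cost of e / 2. *)
have [_ [F [mF AF] <-] Flt] := lb_ereal_inf_adherent e2 Afin.
pose B := \bigcup_i F i.
have mB : measurable B by exact: bigcupT_measurable.
have muB : (mu B <= mu A + (e / 2)%:E)%E.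
  rewrite [mu B]lebesgueE//; apply: le_trans (ltW Flt).
  by apply: measure_sigma_subadditive.
have [_ /(_ _ e2)[k [S [Ssat SO BS SB]]]] := borel_approximable mB.
have mS := measurable_saturated mcell Ssat.
have mB' := borel_measurable mB.
have e2e : ((e / 2)%:E <= e%:E)%E.
  by rewrite lee_fin; lra.
exists k, S; split=> //.
- apply: le_trans (le_trans BS e2e).
  apply: le_measure; rewrite ?inE.
  + exact: measurableD.
  + by apply: measurableD => //; exact: measurableI.
  + by move=> z [Az nS]; split=> //; split; [exact: AO|exact: AF].
- rewrite [e]splitr EFinD.
  have BA : (mu (B `\` A) <= (e / 2)%:E)%E.
    rewrite measureD//; last first.
      by apply: le_lt_trans muB _; rewrite lte_add_pinfty ?ltry// -ge0_fin_numE.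
    rewrite setIidr// leeBlDr//.
    by rewrite addeC.
  apply: le_trans (leeD SB BA).
  apply: le_trans (measureU2 _ _ _).
  + apply: le_measure; rewrite ?inE.
    * exact: measurableD.
    * by apply: measurableU; exact: measurableD.
    * move=> z [Sz nA]; have [Bz|Bz] := pselect (B z); first by right.
      by left.
  + exact: measurableD.
  + exact: measurableD.
Qed.

End approximation.

(** * The parabolic grid *)

Lemma floor_eqP (R : realType) (y T : R) (m : int) : 0 < T ->
  Num.floor (y / T) = m <-> m%:~R * T <= y < (m%:~R + 1) * T.
Proof.
move=> T0; rewrite -ler_pdivlMr// -ltr_pdivrMr//; split=> [<-|H].
  by have := floor_itv (y / T); rewrite intrD.
by apply: floor_def; rewrite intrD.
Qed.

(** Multiples of c T are multiples of T, so no endpoint of the coarse partition lies inside a fine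
    interval. This is where ratios of consecutive scales must be integers. *)
Lemma floor_refine (R : realType) (y y' T : R) (c : nat) : 0 < T -> (0 < c)%N ->
  Num.floor (y / T) = Num.floor (y' / T) ->
  Num.floor (y / (c%:R * T)) = Num.floor (y' / (c%:R * T)).
Proof.
move=> T0 c0; set m := Num.floor (y' / T) => /(floor_eqP _ _ T0)/andP[ym ym1].
have /andP[y'm y'm1] : m%:~R * T <= y' < (m%:~R + 1) * T by exact/floor_eqP.
have cT : 0 < c%:R * T by rewrite mulr_gt0// ltr0n.
set b := Num.floor (y' / (c%:R * T)).
have /andP[y'b y'b1] : b%:~R * (c%:R * T) <= y' < (b%:~R + 1) * (c%:R * T).
  exact/floor_eqP.
have bm : b * c%:Z <= m.
  rewrite -ltzD1 -(ltr_int R) intrD intrM.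
  by rewrite -(ltr_pM2r T0) -mulrA; apply: le_lt_trans y'm1.
have mb : m + 1 <= (b + 1) * c%:Z.
  rewrite lezD1 -(ltr_int R) intrM intrD.
  by rewrite -(ltr_pM2r T0) -mulrA; apply: le_lt_trans y'b1.
apply/floor_eqP => //; apply/andP; split.
  apply: le_trans ym; rewrite mulrA ler_pM2r//.
  by move: bm; rewrite -(ler_int R) intrM.
apply: lt_le_trans ym1 _; rewrite mulrA ler_pM2r//.
by move: mb; rewrite -(ler_int R) intrM !intrD.
Qed.

Section scales.
Variables (R : realType) (p L : R) (M : nat).
Hypotheses (p_gt1 : 1 < p) (L_gt0 : 0 < L) (M_gt1 : (1 < M)%N).

(* As M^p need not be an integer, the duration of a cell is only comparable to side^p:
   M^-2 side^p <= step <= M^-1 side^p. *)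
Definition side k : R := L / M%:R ^+ k.+1.
Definition time_exp k : nat := (Num.truncn (k.+1%:R * p)).+2.
Definition step k : R := L `^ p / M%:R ^+ time_exp k.

Let M0 : 0 < M%:R :> R. Proof. by rewrite ltr0n ltnW. Qed.
Let M1 : 1 < M%:R :> R. Proof. by rewrite ltr1n. Qed.

Lemma side_gt0 k : 0 < side k.
Proof. by rewrite divr_gt0// exprn_gt0. Qed.

Lemma step_gt0 k : 0 < step k.
Proof. by rewrite divr_gt0// ?powR_gt0// exprn_gt0. Qed.

Lemma sideS k : side k = M%:R * side k.+1.
Proof.
rewrite /side (exprS _ k.+1) invfM mulrCA !mulrA mulrK ?unitfE ?gt_eqF//.
Qed.

Lemma sideE k : L = M%:R ^+ k.+1 * side k.
Proof. by rewrite /side mulrC divfK// expf_neq0// gt_eqF. Qed.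

Lemma side_powR k : side k `^ p = L `^ p / M%:R `^ (k.+1%:R * p).
Proof.
rewrite /side powRM ?invr_ge0 ?exprn_ge0// ?ltW//; congr (_ * _).
by rewrite -powR_mulrn ?ltW// -powRN -powRrM mulNr powRN.
Qed.

Lemma side_powRS k : side k `^ p = M%:R `^ p * side k.+1 `^ p.
Proof. by rewrite sideS powRM// ?ltW// side_gt0. Qed.

Lemma M_powR : M%:R <= M%:R `^ p :> R.
Proof. by rewrite -[leLHS](powRr1 (ltW M0)); apply: ler_powR; rewrite ltW. Qed.

Lemma side_powRS_le k : M%:R * side k.+1 `^ p <= side k `^ p.
Proof. by rewrite (side_powRS k) ler_wpM2r ?powR_ge0// M_powR. Qed.

Lemma side_powR0_le : M%:R * side 0 `^ p <= L `^ p.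
Proof.
rewrite [in leRHS](sideE 0) expr1 powRM ?(ltW M0) ?(ltW (side_gt0 _))//.
by rewrite ler_wpM2r ?powR_ge0// M_powR.
Qed.

Lemma side_powR_anti k k' : (k <= k')%N -> side k' `^ p <= side k `^ p.
Proof.
move=> kk'; rewrite -(subnK kk'); elim: (k' - k)%N => //= m IH.
rewrite addSn; apply: le_trans IH; apply: le_trans (side_powRS_le _).
by rewrite ler_peMl ?powR_ge0// ltW.
Qed.

Lemma side_powR_le k k' : (k < k')%N -> M%:R * side k' `^ p <= side k `^ p.
Proof.
move=> kk'; apply: le_trans (side_powRS_le k).
by rewrite ler_wpM2l ?(ltW M0)// side_powR_anti.
Qed.

(** The exponent [time_exp k] exceeds (k + 1) p by more than 1 and by at most 2. The first fact
    gives this inequality, the second gives [step_ge]. *)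
Lemma step_le k : M%:R * step k <= side k `^ p.
Proof.
rewrite side_powR /step mulrCA ler_wpM2l ?powR_ge0//.
rewrite ler_pdivrMr ?exprn_gt0// mulrC ler_pdivlMr ?powR_gt0//.
rewrite -(powR_mulrn _ (ltW M0)) -[X in X * _](powRr1 (ltW M0)) -powRD ?(gt_eqF M0) ?implybT//.
rewrite ler_powR// ?(ltW M1)//.
have := truncn_itv (_ : 0 <= k.+1%:R * p).
rewrite /time_exp -!natr1 => /(_ _)/andP[].
  by rewrite mulr_ge0// ltW// (lt_trans _ p_gt1).
by lra.
Qed.

Lemma step_ge k : side k `^ p <= M%:R ^+ 2 * step k.
Proof.
rewrite side_powR /step mulrCA ler_wpM2l ?powR_ge0//.
rewrite ler_pdivlMr ?exprn_gt0// mulrC ler_pdivrMr ?powR_gt0//.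
rewrite -!(powR_mulrn _ (ltW M0)) -powRD ?(gt_eqF M0) ?implybT//.
rewrite ler_powR// ?(ltW M1)//.
have := truncn_itv (_ : 0 <= k.+1%:R * p).
rewrite /time_exp -!natr1 => /(_ _)/andP[].
  by rewrite mulr_ge0// ltW// (lt_trans _ p_gt1).
by lra.
Qed.

Lemma time_exp_le k : (time_exp k <= time_exp k.+1)%N.
Proof.
rewrite /time_exp !ltnS; apply: le_truncn.
by rewrite ler_pM2r ?ler_nat// (lt_trans _ p_gt1).
Qed.

(** The ratio of consecutive durations may vary with k, but it is an integer, which suffices for the
    time intervals to nest. *)
Lemma stepS k : step k = (M ^ (time_exp k.+1 - time_exp k))%N%:R * step k.+1.
Proof.
rewrite /step; move: (time_exp k) (time_exp k.+1) (time_exp_le k) => a b ab.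
rewrite natrX mulrCA; congr (_ * _).
rewrite -{2}(subnK ab) exprD invfM mulrA divff ?mul1r//.
by rewrite expf_neq0// gt_eqF.
Qed.

Lemma step0E : L `^ p = M%:R ^+ time_exp 0 * step 0.
Proof. by rewrite /step mulrC divfK// expf_neq0// gt_eqF. Qed.

Lemma geometric_small (C e : R) : 0 < e -> exists k, C / M%:R ^+ k.+1 < e.
Proof.
move=> e0; exists (Num.truncn (C / e)).
rewrite ltr_pdivrMr ?exprn_gt0// mulrC -ltr_pdivrMr//.
apply: lt_trans (truncnS_gt _) _.
by rewrite -natrX ltr_nat ltn_expl.
Qed.

Lemma side_small e : 0 < e -> exists k, 2 * side k < e.
Proof.
by move=> /(geometric_small (2 * L))[k H]; exists k; rewrite /side mulrA.
Qed.

Lemma step_small e : 0 < e -> exists k, step k < e.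
Proof.
move=> /(geometric_small (L `^ p))[k H]; exists k; apply: le_lt_trans H.
have sk0 := step_gt0 k.
apply: (@le_trans _ _ (M%:R * step k)); first by rewrite ler_peMl// ltW.
apply: le_trans (step_le k) _.
rewrite side_powR ler_wpM2l ?powR_ge0// lef_pV2 ?posrE ?exprn_gt0 ?powR_gt0//.
rewrite -(powR_mulrn _ (ltW M0)) ler_powR ?(ltW M1)//.
by rewrite ler_peMr// ltW.
Qed.

End scales.

(** One sign carries both symmetries: it multiplies time differences as well as [f - c]. Everything
    is proved for both values of [up] at once, so neither the space nor [f] has to be
    transformed. *)
Definition time_sign (R : realType) (up : bool) : R := if up then 1 else -1.

Lemma time_signN (R : realType) up : time_sign R (~~ up) = - time_sign R up.
Proof. by case: up; rewrite /time_sign /= ?opprK. Qed.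

Definition half_rect (R : realType) (n : nat) (up : bool) p gamma
    (y : n.-tuple R) s l : set (spacetime R n) :=
  if up then prect_up p gamma y s l else prect_lo p gamma y s l.

(** * Boxes with time read in either direction *)

Section slabs.
Variables (R : realType) (n : nat).
Local Notation mu := (lebesgue R n).
Local Notation sgn up := (time_sign R up).

(** A common form for rectangles, their halves, half-open cells and faces, so that measurability and
    measure are computed once for all of them and for both directions of time. *)
Definition slab (up : bool) (s : R) (J : 'I_n -> interval R) (i : interval R) :
    set (spacetime R n) :=
  [set z | (forall j, tnth z.1 j \in J j) /\ sgn up * (z.2 - s) \in i].

Let reflect_itv up s (i : interval R) : interval R :=
  let: Interval a b := i in
  if up then Interval
    (if a is BSide c u then BSide c (s + u) else a)
    (if b is BSide c u then BSide c (s + u) else b)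
  else Interval
    (match b with BSide c u => BSide (~~ c) (s - u) | BInfty c => BInfty _ (~~ c) end)
    (match a with BSide c u => BSide (~~ c) (s - u) | BInfty c => BInfty _ (~~ c) end).

Let reflect_itvE up s b0 a b1 c :
  [set tau : R | sgn up * (tau - s) \in Interval (BSide b0 a) (BSide b1 c)] =
  [set` reflect_itv up s (Interval (BSide b0 a) (BSide b1 c))].
Proof.
rewrite /reflect_itv /time_sign; apply/seteqP; split=> u /=; case: up;
  rewrite !in_itv/=; case: b0; case: b1 => /= /andP[? ?]; apply/andP; split; lra.
Qed.

Let slabE up s (J : 'I_n -> interval R) b0 a b1 c :
  slab up s J (Interval (BSide b0 a) (BSide b1 c)) =
  box (fun j => [set` J j]) `*`
    [set` reflect_itv up s (Interval (BSide b0 a) (BSide b1 c))].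
Proof. by rewrite -reflect_itvE. Qed.

Lemma measurable_slab up s J b0 a b1 c :
  measurable (slab up s J (Interval (BSide b0 a) (BSide b1 c))).
Proof. by rewrite slabE; apply: measurable_boxX => [j|]; exact: measurable_itv. Qed.

Lemma lebesgue_slab up s J b0 a b1 c (w : R) : 0 <= w -> a <= c ->
  (forall j, lebesgue_measure ([set` J j] : set R) = w%:E) ->
  mu (slab up s J (Interval (BSide b0 a) (BSide b1 c))) = (w ^+ n * (c - a))%:E.
Proof.
move=> w0 ac Jw; rewrite slabE lebesgue_boxX; last 2 first.
- by move=> j; exact: measurable_itv.
- exact: measurable_itv.
rewrite (eq_bigr (fun=> w%:E))// prodEFin prodr_const card_ord EFinM; congr (_ * _)%E.
rewrite lebesgue_measure_itv /reflect_itv; case: up => /=.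
- rewrite lte_fin ltrD2l; case: ltP => [_|ca]; first by rewrite -EFinB; congr EFin; lra.
  by rewrite (@le_anti _ _ a c) ?subrr// ac.
- rewrite lte_fin ltrD2l ltrN2; case: ltP => [_|ca].
    by rewrite -EFinB; congr EFin; lra.
  by rewrite (@le_anti _ _ a c) ?subrr// ac.
Qed.

Lemma lebesgue_slab0 up s J b0 a b1 c j :
  lebesgue_measure ([set` J j] : set R) = 0%E ->
  mu (slab up s J (Interval (BSide b0 a) (BSide b1 c))) = 0%E.
Proof.
move=> Jj; rewrite slabE lebesgue_boxX; last 2 first.
- by move=> i; exact: measurable_itv.
- exact: measurable_itv.
by rewrite (bigD1 j)//= Jj !mul0e.
Qed.

Lemma halfE up p gamma (y : n.-tuple R) s l : half_rect up p gamma y s l =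
  slab up s (fun j => `[tnth y j - l, tnth y j + l]) `]gamma * l `^ p, l `^ p[.
Proof.
rewrite /half_rect /slab /time_sign; apply/seteqP; split=> -[v u]; case: up;
  rewrite /prect_up /prect_lo /cube/= !in_itv/=.
- move=> [cv /andP[? ?]]; split; last by apply/andP; split; lra.
  by move=> j; rewrite in_itv/= -ler_distl.
- move=> [cv /andP[? ?]]; split; last by apply/andP; split; lra.
  by move=> j; rewrite in_itv/= -ler_distl.
- move=> [cv /andP[? ?]]; split; last by apply/andP; split; lra.
  by move=> j; have := cv j; rewrite in_itv/= -ler_distl.
- move=> [cv /andP[? ?]]; split; last by apply/andP; split; lra.
  by move=> j; have := cv j; rewrite in_itv/= -ler_distl.
Qed.

Lemma prectE up p (y : n.-tuple R) s l : prect p y s l =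
  slab up s (fun j => `[tnth y j - l, tnth y j + l]) `]- l `^ p, l `^ p[.
Proof.
rewrite /slab /time_sign; apply/seteqP; split=> -[v u];
  rewrite /prect /cube/= !in_itv/=.
- move=> [cv /andP[? ?]]; split; last by case: up; apply/andP; split; lra.
  by move=> j; rewrite in_itv/= -ler_distl.
- case: up => -[cv /andP[? ?]]; (split; last by apply/andP; split; lra);
  by move=> j; have := cv j; rewrite in_itv/= -ler_distl.
Qed.

Let closed_itv_measure (y : n.-tuple R) l : 0 <= l -> forall j,
  lebesgue_measure (`[tnth y j - l, tnth y j + l] : set R) = (2 * l)%:E.
Proof.
move=> l0 j; rewrite lebesgue_measure_itv/= lte_fin.
case: ltP => H; first by rewrite -EFinB; congr EFin; lra.
by congr EFin; lra.
Qed.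

Lemma lebesgue_half up p gamma (y : n.-tuple R) s l : 0 <= l -> gamma <= 1 ->
  mu (half_rect up p gamma y s l) = ((2 * l) ^+ n * ((1 - gamma) * l `^ p))%:E.
Proof.
move=> l0 g1; rewrite halfE (lebesgue_slab _ _ _ _ _ _ (closed_itv_measure y l0)).
- by rewrite mulrBl mul1r.
- by rewrite mulr_ge0.
- by rewrite ler_piMl// powR_ge0.
Qed.

Lemma measurable_half up p gamma (y : n.-tuple R) s l :
  measurable (half_rect up p gamma y s l).
Proof. by rewrite halfE; exact: measurable_slab. Qed.

Lemma measurable_prect p (y : n.-tuple R) s l : measurable (prect p y s l).
Proof. by rewrite (prectE true); exact: measurable_slab. Qed.

Lemma half_prect up p gamma (y : n.-tuple R) s l : 0 <= gamma ->
  half_rect up p gamma y s l `<=` prect p y s l.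
Proof.
move=> g0; rewrite halfE (prectE up) => z [Jz]; rewrite /= in_itv/= => /andP[za zb].
split=> //; rewrite in_itv/= zb andbT; apply: le_lt_trans za.
by rewrite -mulN1r ler_wpM2r ?powR_ge0//; lra.
Qed.

Lemma half_anti up p gamma alpha (y : n.-tuple R) s l : gamma <= alpha ->
  half_rect up p alpha y s l `<=` half_rect up p gamma y s l.
Proof.
move=> ga; rewrite !halfE => z [Jz]; rewrite /= in_itv/= => /andP[za zb].
split=> //; rewrite in_itv/= zb andbT; apply: le_lt_trans za.
by rewrite ler_wpM2r ?powR_ge0.
Qed.

End slabs.

(** * Cells, their shifts in time and the attached rectangles *)

Section grid.
Variables (R : realType) (n : nat) (p gamma alpha : R) (M : nat) (up : bool).
Variables (x : n.-tuple R) (t L : R).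
Hypotheses (p_gt1 : 1 < p) (gamma_ge0 : 0 <= gamma) (gamma_lt_alpha : gamma < alpha)
  (alpha_lt1 : alpha < 1) (L_gt0 : 0 < L) (M_gap : 3 < M%:R * (alpha - gamma)).
Local Notation X := (spacetime R n).
Local Notation mu := (lebesgue R n).
Local Notation sgn := (time_sign R up).
Local Notation l := (side L M).
Local Notation tau := (step p L M).
Local Notation lp k := (side L M k `^ p).

(* Time is measured from the end of the rectangle in the direction [up], so that both
   halves obey the same computations: the rectangle is -2 L^p < depth < 0. *)
Definition depth (z : X) : R := sgn * (z.2 - t) - L `^ p.

(** Space is anchored at the corner [x - L] and time at depth 0. As L is an integer multiple of each
    side, the faces of the cube and the end of the rectangle are cell boundaries at every
    generation. *)
Definition grid_idx k (z : X) : n.-tuple int * int :=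
  ([tuple Num.floor ((tnth z.1 j - tnth x j + L) / (2 * l k)) | j < n],
   Num.floor (depth z / tau k)).

(** The least integer with [lag k * tau k] > (1 + gamma) side^p. This is the distance from the end
    of the attached rectangle to the end of its lower part, so the shifted cell clears the middle
    gap. *)
Definition lag k : int := Num.floor ((1 + gamma) * lp k / tau k) + 1.

Definition delay k (i : n.-tuple int * int) := (i.1, i.2 - lag k).

Definition gslab k (a : n.-tuple int) (u w : R) : set X :=
  slab up t (fun j => `[tnth x j - L + (tnth a j)%:~R * (2 * l k),
                        tnth x j - L + ((tnth a j)%:~R + 1) * (2 * l k)[)
    `[u + L `^ p, w + L `^ p[.

(** D^- ends at index [i.2 - lag k + 1], and a point of a finer cell D' comes at most [lag k + 1]
    steps of generation k after the start of D'^-. Hence the end [i.2 + 2]. *)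
Definition dilate k (i : n.-tuple int * int) : set X :=
  gslab k i.1 ((i.2 - lag k)%:~R * tau k) ((i.2%:~R + 2) * tau k).

Definition center k (i : n.-tuple int * int) : n.-tuple R :=
  [tuple tnth x j - L + (2 * (tnth i.1 j)%:~R + 1) * l k | j < n].

(** Chosen so that the rectangle ends exactly when the cell does. Its cube is the closure of the
    spatial cell, whose width is [2 * l k]. *)
Definition tcenter k (i : n.-tuple int * int) : R :=
  t + sgn * ((i.2%:~R + 1) * tau k - lp k + L `^ p).

Definition front k i := half_rect up p gamma (center k i) (tcenter k i) (l k).
Definition back k i := half_rect (~~ up) p gamma (center k i) (tcenter k i) (l k).

Let ag1 : alpha - gamma < 1.
Proof. have h := gamma_ge0; have h' := alpha_lt1; lra. Qed.
Let M3 : 3 < M%:R :> R.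
Proof. apply: lt_le_trans M_gap _; rewrite ler_piMr ?ler0n// ltW//. Qed.
Let M_gt1 : (1 < M)%N.
Proof. by rewrite -(ltr_nat R); have := M3; lra. Qed.
Let lk0 k : 0 < l k. Proof. exact: side_gt0. Qed.
Let tau0 k : 0 < tau k. Proof. exact: step_gt0. Qed.
Let lp0 k : 0 < lp k. Proof. exact: powR_gt0. Qed.
Let l20 k : 0 < 2 * l k. Proof. by rewrite mulr_gt0. Qed.
Let sgn2 : sgn * sgn = 1.
Proof. by rewrite /time_sign; case: up; lra. Qed.

Lemma in_gslab k a u w z : gslab k a u w z <->
  (forall j, (tnth a j)%:~R * (2 * l k) <= tnth z.1 j - tnth x j + L
             < ((tnth a j)%:~R + 1) * (2 * l k)) /\ u <= depth z < w.
Proof.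
rewrite /gslab /slab /depth /=; split=> -[zJ zi]; split.
- by move=> j; have := zJ j; rewrite in_itv/= => /andP[? ?]; apply/andP; split; lra.
- by move: zi; rewrite in_itv/= => /andP[? ?]; apply/andP; split; lra.
- by move=> j; have := zJ j; rewrite in_itv/= => /andP[? ?]; apply/andP; split; lra.
- by move: zi; rewrite in_itv/= => /andP[? ?]; apply/andP; split; lra.
Qed.

Lemma grid_idxP k z i : grid_idx k z = i <->
  (forall j, (tnth i.1 j)%:~R * (2 * l k) <= tnth z.1 j - tnth x j + L
             < ((tnth i.1 j)%:~R + 1) * (2 * l k)) /\
  i.2%:~R * tau k <= depth z < (i.2%:~R + 1) * tau k.
Proof.
split=> [<-|[zJ zi]].
  by split=> [j|]; rewrite ?tnth_mktuple; apply/floor_eqP.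
case: i zJ zi => a m /= zJ zi; congr pair; last exact/floor_eqP.
by apply: eq_from_tnth => j; rewrite tnth_mktuple; apply/floor_eqP.
Qed.

Lemma grid_cellE k i :
  cell grid_idx k i = gslab k i.1 (i.2%:~R * tau k) ((i.2%:~R + 1) * tau k).
Proof. by apply/seteqP; split=> z; rewrite /cell/= grid_idxP in_gslab. Qed.

Lemma measurable_grid_cell k i : measurable (cell grid_idx k i).
Proof. by rewrite grid_cellE; exact: measurable_slab. Qed.

Lemma grid_idxS k z z' : grid_idx k.+1 z = grid_idx k.+1 z' ->
  grid_idx k z = grid_idx k z'.
Proof.
move=> H; have H1 := congr1 fst H; have H2 := congr1 snd H.
congr pair; last first.
  rewrite (stepS _ p_gt1 M_gt1); apply: floor_refine => //.
  by rewrite expn_gt0 (ltnW M_gt1).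
apply: eq_from_tnth => j; rewrite !tnth_mktuple.
have := congr1 (fun g => tnth g j) H1; rewrite !tnth_mktuple => Hj.
rewrite (sideS _ M_gt1 k) mulrCA; apply: floor_refine => //.
exact: ltnW.
Qed.

Lemma mu_gslab k a u w : u <= w ->
  mu (gslab k a u w) = ((2 * l k) ^+ n * (w - u))%:E.
Proof.
move=> uw; rewrite (@lebesgue_slab _ _ _ _ _ _ _ _ _ (2 * l k)).
- by congr ((_ * _)%:E); lra.
- exact: ltW.
- by rewrite lerD2r.
- move=> j; rewrite lebesgue_measure_itv/= lte_fin.
  have l20k := l20 k; case: ltP => H; first by rewrite -EFinB; congr EFin; lra.
  by congr EFin; nra.
Qed.

Lemma mu_grid_cell k i : mu (cell grid_idx k i) = ((2 * l k) ^+ n * tau k)%:E.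
Proof.
rewrite grid_cellE mu_gslab; first by congr ((_ * _)%:E); lra.
by have := tau0 k; nra.
Qed.

Lemma delay_inj k : injective (delay k).
Proof. by move=> [a m] [a' m'] [-> /addIr ->]. Qed.

Lemma lag_bounds k : (1 + gamma) * lp k < (lag k)%:~R * tau k <= (1 + gamma) * lp k + tau k.
Proof.
have : Num.floor ((1 + gamma) * lp k / tau k) = lag k - 1 by rewrite /lag addrK.
by move/(floor_eqP _ _ (tau0 k)) => /andP[]; rewrite intrB => ? ?; apply/andP; split; lra.
Qed.

Let Mtau k : M%:R * tau k <= lp k. Proof. exact: step_le. Qed.

(** This keeps the shifted cell from starting before the rectangle. By [M_gap] and M tau <= side^p,
    three steps are shorter than (1 - gamma) side^p; two are spent here, on rounding the lag and on
    the cell itself. *)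
Lemma lag_lt k : ((lag k)%:~R + 1) * tau k < 2 * lp k.
Proof.
have /andP[_ H] := lag_bounds k; have := Mtau k; have := tau0 k; have := lp0 k.
have := M_gap; have := gamma_lt_alpha; have := alpha_lt1; have := gamma_ge0.
move=> ? ? ? ? ? ? MT.
suff : 2 * tau k < (1 - gamma) * lp k by lra.
by nra.
Qed.

Let lag_gt0 k : 0 < (lag k)%:~R * tau k.
Proof.
have /andP[H _] := lag_bounds k; apply: le_lt_trans H.
by rewrite mulr_ge0 ?(ltW (lp0 k))//; have := gamma_ge0; lra.
Qed.

Let lag_ge1 k : 1 <= (lag k)%:~R :> R.
Proof. by have := lag_gt0 k; rewrite pmulr_lgt0// ltr0z ler1z gtz0_ge1. Qed.

(** Comes from the separation of generations: for k < k' the left side is below 2 side_k'^p, the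
    right side is above side_k^p, and the ratio of these powers is at least M > 3. *)
Lemma lag_anti k k' : (k <= k')%N ->
  ((lag k')%:~R + 1) * tau k' <= ((lag k)%:~R + 1) * tau k.
Proof.
rewrite leq_eqVlt => /predU1P[->//|kk'].
have := side_powR_le p_gt1 L_gt0 M_gt1 kk'; have := lag_lt k'.
have /andP[+ _] := lag_bounds k; have := lp0 k'; have := M3.
have := tau0 k; have := gamma_ge0; have := lp0 k.
move=> h1 h2 h3 h4 h5 h6 h7 h8.
have : 0 <= gamma * lp k by rewrite mulr_ge0// ltW.
have : 2 * lp k' <= M%:R * lp k' by rewrite ler_pM2r//; lra.
lra.
Qed.

Lemma measurable_dilate k i : measurable (dilate k i).
Proof. exact: measurable_slab. Qed.

Lemma mu_dilate k i : (mu (dilate k i) <=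
  (2 * M%:R ^+ 2 + 2)%:E * mu (cell grid_idx k (delay k i)))%E.
Proof.
have := step_ge p_gt1 L_gt0 M_gt1 k; have := lag_lt k; have := tau0 k.
have := lag_ge1 k => h1 h2 h3 h4.
have ge0 : 0 <= (2 * l k) ^+ n by rewrite exprn_ge0// ltW.
rewrite mu_grid_cell mu_gslab; last by rewrite ler_pM2r// intrB; lra.
rewrite -EFinM lee_fin [leRHS]mulrCA ler_wpM2l// intrB.
lra.
Qed.

Lemma cell_dilate k k' i i' : (k <= k')%N ->
  cell grid_idx k' (delay k' i') `&` cell grid_idx k (delay k i) !=set0 ->
  cell grid_idx k' i' `<=` dilate k i.
Proof.
move=> kk' [w [wi' wi]] z zi'.
have wk := wi; move: wk => /grid_idxP[wJ /andP[w1 w2]].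
have wk' := wi'; move: wk' => /grid_idxP[w'J /andP[w1' w2']].
have zk' := zi'; move: zk' => /grid_idxP[zJ /andP[z1 z2]].
(* The delay leaves spatial labels unchanged, so the point with the space coordinate of [z] and the
   time of [w] lies in D'^-. Nesting of cells then gives the spatial inclusion. *)
pose z' : X := (z.1, w.2).
have z'i' : grid_idx k' z' = delay k' i'.
  by apply/grid_idxP; split; [exact: zJ|apply/andP].
have z'i : grid_idx k z' = delay k i.
  by rewrite -wi; apply: (idx_le grid_idxS kk'); rewrite z'i' wi'.
apply/in_gslab; split.
  by move/grid_idxP : z'i => [].
have := lag_anti kk'; have := lag_ge1 k'; have := tau0 k'.
move: w1 w2 w1' w2'; rewrite /delay/= !intrB => *.
apply/andP; split; nra.
Qed.

Lemma in_front k i z : front k i z <->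
  (forall j, `|tnth z.1 j - tnth x j + L - (2 * (tnth i.1 j)%:~R + 1) * l k| <= l k) /\
  (i.2%:~R + 1) * tau k - (1 - gamma) * lp k < depth z < (i.2%:~R + 1) * tau k.
Proof.
rewrite /front halfE /slab/=.
have -> : sgn * (z.2 - tcenter k i) = depth z - (i.2%:~R + 1) * tau k + lp k.
  by rewrite /depth /tcenter mulrBr mulrDr mulrA sgn2; lra.
rewrite in_itv/=; split=> -[zJ /andP[? ?]]; (split; last by apply/andP; split; lra).
  move=> j; have := zJ j; rewrite in_itv/= tnth_mktuple ler_norml => /andP[? ?].
  by apply/andP; split; lra.
move=> j; have := zJ j; rewrite in_itv/= tnth_mktuple ler_norml => /andP[? ?].
by apply/andP; split; lra.
Qed.

Lemma in_back k i z : back k i z <->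
  (forall j, `|tnth z.1 j - tnth x j + L - (2 * (tnth i.1 j)%:~R + 1) * l k| <= l k) /\
  (i.2%:~R + 1) * tau k - 2 * lp k < depth z
    < (i.2%:~R + 1) * tau k - (1 + gamma) * lp k.
Proof.
rewrite /back halfE /slab/=.
have -> : time_sign R (~~ up) * (z.2 - tcenter k i) =
    - (depth z - (i.2%:~R + 1) * tau k + lp k).
  by rewrite time_signN /depth /tcenter mulNr mulrBr mulrDr mulrA sgn2; lra.
rewrite in_itv/=; split=> -[zJ /andP[? ?]]; (split; last by apply/andP; split; lra).
  move=> j; have := zJ j; rewrite in_itv/= tnth_mktuple ler_norml => /andP[? ?].
  by apply/andP; split; lra.
move=> j; have := zJ j; rewrite in_itv/= tnth_mktuple ler_norml => /andP[? ?].
by apply/andP; split; lra.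
Qed.

Let cell_center k (a : int) (y : R) :
  a%:~R * (2 * l k) <= y < (a%:~R + 1) * (2 * l k) ->
  `|y - (2 * a%:~R + 1) * l k| <= l k.
Proof. by move=> /andP[? ?]; rewrite ler_norml; apply/andP; split; lra. Qed.

Let step_gap k : 3 * tau k < (1 - gamma) * lp k.
Proof.
have := Mtau k; have := tau0 k; have := lp0 k; have := M_gap.
have := gamma_lt_alpha; have := alpha_lt1; have := gamma_ge0 => *.
nra.
Qed.

Lemma cell_front k i : cell grid_idx k i `<=` front k i.
Proof.
move=> z /grid_idxP[zJ /andP[z1 z2]]; apply/in_front; split.
  by move=> j; exact: cell_center.
have := step_gap k; have := tau0 k => *.
by apply/andP; split; lra.
Qed.

Lemma delay_back k i : cell grid_idx k (delay k i) `<=` back k i.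
Proof.
move=> z /grid_idxP[zJ /andP[]]; rewrite /delay/= intrB => z1 z2.
apply/in_back; split; first by move=> j; exact: cell_center.
have := step_gap k; have := tau0 k; have := lag_lt k.
have /andP[] := lag_bounds k => *.
by apply/andP; split; lra.
Qed.

(** The strict inequality is essential: at equal generations the shifted cell lies in the lower
    half. One generation further, the delay is already short compared with the upper half of the
    coarser rectangle. *)
Lemma delay_front k k' z : (k < k')%N ->
  cell grid_idx k' (delay k' (grid_idx k' z)) `<=` front k (grid_idx k z).
Proof.
move=> kk' w wi; have wk := wi; move: wk => /grid_idxP[wJ /andP[w1 w2]].
have [zJ /andP[z1 z2]] := (grid_idxP k' z _).1 erefl.
have [zJk /andP[z1k z2k]] := (grid_idxP k z _).1 erefl.
pose z' : X := (w.1, z.2).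
have z'z : grid_idx k z' = grid_idx k z.
  by apply: (idx_le grid_idxS (ltnW kk')); apply/grid_idxP; split; [exact: wJ|apply/andP].
apply/in_front; split.
  move=> j; apply: cell_center.
  by move/grid_idxP : z'z => [/(_ j)].
have := side_powR_le p_gt1 L_gt0 M_gt1 kk'; have := lag_lt k'.
have := lag_ge1 k'; have := tau0 k'; have := tau0 k; have := lp0 k; have := lp0 k'.
have := Mtau k; have := M_gap; have := gamma_lt_alpha; have := alpha_lt1.
move: w1 w2; rewrite /delay/= intrB => w1 w2 h1 h2 h3 h4 h5 h6 h7 h8 h9 h10 h11.
(* Two thirds of this inequality and one third of [step_gap] add up to 2 side_k'^p + tau_k < (1 -
   gamma) side_k^p, which covers the delay and the position of [z] in its coarse cell. *)
have : 3 * lp k' < (1 - gamma) * lp k by nra.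
have := step_gap k => *.
apply/andP; split; last by nra.
have : 2 * lp k' + tau k < (1 - gamma) * lp k by lra.
by nra.
Qed.

Lemma mu_parent k z : (mu (cell grid_idx k (grid_idx k z)) <=
  (M%:R ^+ n * M%:R `^ p * M%:R ^+ 2)%:E *
    mu (cell grid_idx k.+1 (grid_idx k.+1 z)))%E.
Proof.
rewrite !mu_grid_cell -EFinM lee_fin (sideS _ M_gt1 k).
have -> : (2 * (M%:R * l k.+1)) ^+ n = M%:R ^+ n * (2 * l k.+1) ^+ n.
  by rewrite mulrCA exprMn.
have h1 := step_ge p_gt1 L_gt0 M_gt1 k.+1.
have h2 := Mtau k; have h3 := side_powRS p L_gt0 M_gt1 k; have h4 := tau0 k; have h5 := M3.
have h6 : tau k <= M%:R `^ p * M%:R ^+ 2 * tau k.+1.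
  apply: (@le_trans _ _ (lp k)).
    by apply: le_trans h2; rewrite ler_peMl ?(ltW h4)//; lra.
  by rewrite h3 -mulrA ler_wpM2l// powR_ge0.
have : 0 <= M%:R ^+ n * (2 * l k.+1) ^+ n by rewrite mulr_ge0// exprn_ge0// ltW.
move: (M%:R ^+ n) ((2 * l k.+1) ^+ n) (M%:R `^ p) (M%:R ^+ 2) h6 => a b c d h6 ab0.
have -> : a * c * d * (b * tau k.+1) = a * b * (c * d * tau k.+1) by ring.
by rewrite ler_wpM2l.
Qed.

(* Cells are half-open, so the right faces of the closed cube have to be discarded. *)
Definition region : set X := [set z | exists z0 : X,
  [/\ half_rect up p alpha x t L z0, forall j, tnth z0.1 j < tnth x j + L &
     grid_idx 0 z0 = grid_idx 0 z]].

Lemma region_saturated : saturated grid_idx 0 region.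
Proof. by move=> z z' zz' [z0 [? ? zz0]]; exists z0; split=> //; rewrite zz0. Qed.

(** The cube is tiled exactly: 2 L is M^(k+1) cell widths, so the cell of a point of the half-open
    cube does not cross its boundary. *)
Let index_bounds k (a : int) (y : R) :
  a%:~R * (2 * l k) <= y < (a%:~R + 1) * (2 * l k) ->
  0 <= y < 2 * L -> 0 <= a%:~R :> R /\ (a%:~R + 1) * (2 * l k) <= 2 * L.
Proof.
move=> /andP[ay ya] /andP[y0 yL]; split.
  have : 0 < (a%:~R + 1) * (2 * l k) by exact: le_lt_trans ya.
  by rewrite pmulr_lgt0// -(intrD _ a 1) ltr0z ler0z ltzD1.
have LE : 2 * L = M%:R ^+ k.+1 * (2 * l k) by rewrite {1}(sideE L M_gt1 k) mulrCA.
have : a%:~R * (2 * l k) < M%:R ^+ k.+1 * (2 * l k) by rewrite -LE (le_lt_trans ay).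
have MkE : M%:R ^+ k.+1 = (M ^ k.+1)%N%:Z%:~R :> R by rewrite -natrX.
rewrite LE MkE !ler_pM2r// !ltr_pM2r// ltr_int -lezD1 -(ler_int R) intrD.
exact.
Qed.

Lemma region_bounds z : region z ->
  (forall j, 0 <= tnth z.1 j - tnth x j + L < 2 * L) /\
  - ((1 - alpha) * L `^ p) - tau 0 < depth z < 0.
Proof.
move=> [z0 [+ z0L z0z]]; rewrite halfE => -[z0J].
rewrite -/(sgn * _) in_itv/= => /andP[z0a z0b].
have [zJ /andP[z1 z2]] := (grid_idxP 0 z _).1 erefl.
have [z0J' /andP[z01 z02]] := (grid_idxP 0 z0 _).1 z0z.
split.
  move=> j; have := zJ j; have := z0J' j => h h'.
  have [|h0 h1] := index_bounds h.
    by have := z0J j; have := z0L j; rewrite in_itv/= => ? /andP[? ?]; apply/andP; split; lra.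
  have {h'} /andP[h2 h3] := h'; apply/andP; split.
    by apply: le_trans h2; rewrite mulr_ge0// ltW.
  exact: lt_le_trans h1.
have z0d : depth z0 < 0 by rewrite /depth; lra.
have z0d' : - ((1 - alpha) * L `^ p) < depth z0 by rewrite /depth; lra.
apply/andP; split; first by lra.
apply: lt_le_trans z2 _.
have : (grid_idx 0 z).2%:~R * tau 0 < 0 by exact: le_lt_trans z0d.
rewrite pmulr_llt0// ltrz0 -lezD1 -(ler_int R) intrD.
by have := tau0 0 => *; nra.
Qed.

Lemma region_step z k : region z -> ((grid_idx k z).2%:~R + 1) * tau k <= 0.
Proof.
move=> /region_bounds[_ /andP[_ z0]].
have [_ /andP[z1 _]] := (grid_idxP k z _).1 erefl.
have : (grid_idx k z).2%:~R * tau k < 0 by exact: le_lt_trans z0.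
rewrite pmulr_llt0// ltrz0 -lezD1 -(ler_int R) intrD.
by have := tau0 k => *; nra.
Qed.

(** Here the gap alpha - gamma is used. [region] may precede R^+(alpha) by one step of generation 0,
    and a shifted cell goes back by less than 2 side^p more; together this stays inside
    R^+(gamma). *)
Let lpL k : 3 * lp k < (alpha - gamma) * L `^ p.
Proof.
have h1 := side_powR_anti p_gt1 L_gt0 M_gt1 (leq0n k).
have h2 := side_powR0_le p_gt1 L_gt0 M_gt1.
have h3 := lp0 k; have h4 := M_gap; have h5 := M3; have h6 := gamma_lt_alpha.
have : M%:R * lp k <= L `^ p by apply: le_trans h2; rewrite ler_pM2l//; lra.
by nra.
Qed.

Let tauL k : tau k < lp k.
Proof. by have := Mtau k; have := tau0 k; have := M3 => *; nra. Qed.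

Lemma center_sub z k : region z ->
  prect p (center k (grid_idx k z)) (tcenter k (grid_idx k z)) (l k)
    `<=` prect p x t L.
Proof.
move=> rz; have [zb /andP[d1 d2]] := region_bounds rz; have z2 := region_step k rz.
have [zJ /andP[z3 z4]] := (grid_idxP k z _).1 erefl.
rewrite !(prectE up) => w [wJ].
have -> : sgn * (w.2 - tcenter k (grid_idx k z)) =
    sgn * (w.2 - t) - L `^ p - ((grid_idx k z).2%:~R + 1) * tau k + lp k.
  by rewrite /tcenter mulrBr mulrDr mulrA sgn2; lra.
rewrite in_itv/= => /andP[w1 w2]; split.
  move=> j; have := wJ j; rewrite !in_itv/= tnth_mktuple.
  have [h1 h2] := index_bounds (zJ j) (zb j); have := lk0 k => h3.
  have h4 : 0 <= (tnth (grid_idx k z).1 j)%:~R * l k by rewrite mulr_ge0// ltW.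
  by move=> /andP[? ?]; apply/andP; split; lra.
rewrite /= in_itv/=; have := lpL k; have := lpL 0; have := tauL 0; have := lp0 k; have := lp0 0.
have := gamma_ge0; have := alpha_lt1; have := gamma_lt_alpha => *.
have : 0 < L `^ p by exact: powR_gt0.
move=> *; apply/andP; split; last by lra.
by nra.
Qed.

Lemma delay_region z k : region z ->
  cell grid_idx k (delay k (grid_idx k z)) `<=` half_rect up p gamma x t L.
Proof.
move=> rz w wi; have [zb /andP[d1 d2]] := region_bounds rz; have z2 := region_step k rz.
have [zJ /andP[z3 z4]] := (grid_idxP k z _).1 erefl.
have [wJ /andP[]] := (grid_idxP k w _).1 wi; rewrite /= intrB => w3 w4.
rewrite halfE; split.
  move=> j; have := wJ j; have [h1 h2] := index_bounds (zJ j) (zb j).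
  have h4 : 0 <= (tnth (grid_idx k z).1 j)%:~R * (2 * l k) by rewrite mulr_ge0// ltW.
  by rewrite in_itv/= => /andP[? ?]; apply/andP; split; lra.
have -> : sgn * (w.2 - t) = depth w + L `^ p by rewrite /depth subrK.
rewrite /= in_itv/=; have := lpL k; have := lpL 0; have := tauL 0; have := lp0 k; have := lp0 0.
have := lag_lt k; have /andP[+ _] := lag_bounds k.
have := gamma_ge0; have := alpha_lt1; have := gamma_lt_alpha => *.
have : 0 <= gamma * lp k by rewrite mulr_ge0// ltW.
by move=> *; apply/andP; split; lra.
Qed.

Lemma region_sub : region `<=` half_rect up p gamma x t L.
Proof.
move=> z rz; have [zb /andP[d1 d2]] := region_bounds rz.
rewrite halfE; split.
  by move=> j; have := zb j; rewrite in_itv/= => /andP[? ?]; apply/andP; split; lra.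
have -> : sgn * (z.2 - t) = depth z + L `^ p by rewrite /depth subrK.
rewrite /= in_itv/=; have := lpL 0; have := tauL 0; have := lp0 0.
by move=> *; apply/andP; split; lra.
Qed.

Lemma measurable_region : measurable region.
Proof. exact: (measurable_saturated measurable_grid_cell region_saturated). Qed.

Lemma region_fin : (mu region < +oo)%E.
Proof.
apply: (@le_lt_trans _ _ (mu (half_rect up p gamma x t L))).
  apply: le_measure; rewrite ?inE; last exact: region_sub.
  - exact: measurable_region.
  - exact: measurable_half.
rewrite lebesgue_half ?ltry ?(ltW L_gt0)//.
by have := alpha_lt1; have := gamma_lt_alpha => *; lra.
Qed.

Lemma region_cover : mu (half_rect up p alpha x t L `\` region) = 0%E.
Proof.
pose face (j : 'I_n) : set X := slab up t
  (fun i => if i == j then `[tnth x i + L, tnth x i + L] else `[tnth x i - L, tnth x i + L])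
  `]alpha * L `^ p, L `^ p[.
have face0 j : mu (face j) = 0%E.
  apply: (@lebesgue_slab0 _ _ _ _ _ _ _ _ _ j).
  by rewrite eqxx lebesgue_measure_itv/= ltxx.
have mface j : measurable (face j) by exact: measurable_slab.
apply/eqP; rewrite eq_le measure_ge0 andbT.
rewrite -(measure0_bigcup mface face0).
apply: le_measure; rewrite ?inE.
- by apply: measurableD; [exact: measurable_half|exact: measurable_region].
- exact: countable_bigcup_measurable.
move=> z [zh nz].
have [[j zj]|/forallNP zj] := pselect (exists j, tnth x j + L <= tnth z.1 j).
  exists j => //.
  move: zh; rewrite halfE => -[zJ zi]; split=> // i.
  have [->|_] := eqVneq i j; last exact: zJ.
  by have := zJ j; rewrite !in_itv/= zj => /andP[_ ->].
exfalso; apply: nz; exists z; split=> // j.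
by have /negP := zj j; rewrite -ltNge.
Qed.

End grid.

(** * Decay of the level sets *)

Lemma three_quarters_lt (R : realFieldType) (m : R) :
  0 < m -> m <= 4^-1 * m + 2^-1 * m -> False.
Proof. by move=> ? ?; lra. Qed.

Section weak_john_nirenberg.
Variables (R : realType) (n : nat) (p gamma alpha : R) (M : nat) (up : bool).
Variables (x : n.-tuple R) (t L : R).
Hypotheses (p_gt1 : 1 < p) (gamma_ge0 : 0 <= gamma) (gamma_lt_alpha : gamma < alpha)
  (alpha_lt1 : alpha < 1) (L_gt0 : 0 < L) (M_gap : 3 < M%:R * (alpha - gamma)).
Local Notation X := (spacetime R n).
Local Notation mu := (lebesgue R n).
Local Notation sgn := (time_sign R up).
Local Notation l := (side L M).
Local Notation tau := (step p L M).
Local Notation lp k := (side L M k `^ p).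
Local Notation idx := (grid_idx p M up x t L).
Local Notation Om := (region p alpha M up x t L).
Local Notation sh := (delay p gamma M L).

Let M3 : 3 < M%:R :> R.
Proof.
have h := gamma_ge0; have h' := alpha_lt1; have h2 := gamma_lt_alpha.
by apply: lt_le_trans M_gap _; rewrite ler_piMr ?ler0n//; lra.
Qed.
Let M_gt1 : (1 < M)%N.
Proof. by rewrite -(ltr_nat R); have := M3; lra. Qed.
Let lk0 k : 0 < l k. Proof. exact: side_gt0. Qed.
Let tau0 k : 0 < tau k. Proof. exact: step_gt0. Qed.
Let lp0 k : 0 < lp k. Proof. exact: powR_gt0. Qed.

Let mcell k i : measurable (cell idx k i).
Proof. exact: (measurable_grid_cell p up x t gamma_ge0 alpha_lt1 L_gt0 M_gap). Qed.

Let idxS k z z' : idx k.+1 z = idx k.+1 z' -> idx k z = idx k z'.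
Proof. exact: (grid_idxS p_gt1 gamma_ge0 alpha_lt1 L_gt0 M_gap). Qed.

Lemma region_approximate (B : set X) : measurable B -> B `<=` Om ->
  forall e, 0 < e -> exists k S, [/\ saturated idx k S, S `<=` Om,
    (mu (B `\` S) <= e%:E)%E & (mu (S `\` B) <= e%:E)%E].
Proof.
apply: (@approximate _ _ _ idx idxS mcell Om (@region_saturated _ _ _ _ _ _ _ _ _)
  (region_fin up x t p_gt1 gamma_ge0 gamma_lt_alpha alpha_lt1 L_gt0 M_gap)
  (fun j k i => tnth x j - L + (tnth i.1 j)%:~R * (2 * l k))
  (* Lower ends in true time. When [up] is false, time decreases with depth, so the lower end
     belongs to the upper index [i.2 + 1]. *)
  (fun k i => if up then t + L `^ p + i.2%:~R * tau k
              else t - L `^ p - (i.2%:~R + 1) * tau k)).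
- move=> j k z.
  have [/(_ j)/andP[? ?] _] := (grid_idxP p up x t gamma_ge0 alpha_lt1 L_gt0 M_gap k z _).1 erefl.
  by lra.
- move=> k z.
  have [_] := (grid_idxP p up x t gamma_ge0 alpha_lt1 L_gt0 M_gap k z _).1 erefl.
  by rewrite /depth /time_sign; case: up => /andP[? ?]; lra.
- move=> j z e /(side_small L M_gt1)[k ke]; exists k.
  have [/(_ j)/andP[? ?] _] := (grid_idxP p up x t gamma_ge0 alpha_lt1 L_gt0 M_gap k z _).1 erefl.
  by lra.
- move=> z e /(step_small p_gt1 L_gt0 M_gt1)[k ke]; exists k.
  have [_] := (grid_idxP p up x t gamma_ge0 alpha_lt1 L_gt0 M_gap k z _).1 erefl.
  by rewrite /depth /time_sign; case: up => /andP[? ?]; lra.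
Qed.

Variables (q K N theta : R) (g : X -> R).
Hypotheses (K_gt0 : 0 < K) (N_gt0 : 0 < N) (q_gt0 : 0 < q) (theta_ge0 : 0 <= theta).
Hypothesis mg : measurable_fun (prect p x t L) g.
Local Notation omega := ((K / 2) `^ (- q)).
Local Notation C1 := (2 * M%:R ^+ 2 + 2 : R).
Local Notation C4 := (M%:R ^+ n * M%:R `^ p * M%:R ^+ 2 : R).
Hypothesis K_osc : omega * M%:R ^+ 2 <= 4^-1.
Hypothesis K_decay : 2 * C1 * (omega * M%:R ^+ 2) * C4 <= theta.
Hypothesis K_top : omega * M%:R ^+ (n + time_exp p 0) <= 2^-1.
Hypothesis osc_weak : forall y s r, 0 < r -> prect p y s r `<=` prect p x t L ->
  exists c, forall k, 0 < k ->
    (mu (half_rect up p gamma y s r `&` [set z | c + k * N < g z])%R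
      <= (k `^ (- q))%:E * mu (half_rect up p gamma y s r))%E /\
    (mu (half_rect (~~ up) p gamma y s r `&` [set z | g z < c - k * N])%R
      <= (k `^ (- q))%:E * mu (half_rect (~~ up) p gamma y s r))%E.
Hypothesis osc_top : forall k, 0 < k ->
  (mu (half_rect up p gamma x t L `&` [set z | k * N < g z])%R
     <= (k `^ (- q))%:E * mu (half_rect up p gamma x t L))%E.

(** Cut down to the rectangle because [g] is known to be measurable only there. *)
Let G lam : set X := prect p x t L `&` [set z | lam < g z].

Let measurable_gt A lam : measurable A -> A `<=` prect p x t L ->
  measurable (A `&` [set z | lam < g z]).
Proof.
move=> mA AP; apply: measurable_superlevel => //.
exact: (measurable_funS (measurable_prect p x t L) AP mg).
Qed.

Let measurable_lt A lam : measurable A -> A `<=` prect p x t L ->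
  measurable (A `&` [set z | g z < lam]).
Proof.
move=> mA AP; have mgA := measurable_funS (measurable_prect p x t L) AP mg.
have := mgA mA _ (measurable_itv `]-oo, lam[).
by congr measurable; congr (_ `&` _); apply/seteqP; split=> z /=; rewrite in_itv/=.
Qed.

Let mG lam : measurable (G lam).
Proof. by apply: measurable_gt => //; exact: measurable_prect. Qed.

Let G_anti a b : a <= b -> G b `<=` G a.
Proof. by move=> ab z [Pz /= bz]; split=> //=; exact: le_lt_trans bz. Qed.

Let bad_cell k i lam := bad mu idx sh G k i lam.
Let excess_set lam := excess mu idx sh G Om lam.

Let omega_ge0 : 0 <= omega. Proof. exact: powR_ge0. Qed.

Let gamma_lt1 : gamma < 1.
Proof. by have h := gamma_lt_alpha; have h' := alpha_lt1; lra. Qed.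

Let mu_cell k i : mu (cell idx k i) = ((2 * l k) ^+ n * tau k)%:E.
Proof. exact: (mu_grid_cell p up x t gamma_ge0 alpha_lt1 L_gt0 M_gap). Qed.

Let mu_half_cell b k y s i : (mu (half_rect b p gamma y s (l k)) <=
  (M%:R ^+ 2)%:E * mu (cell idx k i))%E.
Proof.
rewrite lebesgue_half ?(ltW (lk0 k)) ?(ltW gamma_lt1)// mu_cell -EFinM lee_fin.
have a0 : 0 <= (2 * l k) ^+ n by apply: exprn_ge0; have := lk0 k; lra.
rewrite [leRHS]mulrCA; apply: ler_wpM2l => //.
apply: le_trans (step_ge p_gt1 L_gt0 M_gt1 k).
by rewrite ler_piMl ?(ltW (lp0 k))//; have := gamma_ge0; lra.
Qed.

Lemma osc_good k z lam : Om z -> ~ bad_cell k (idx k z) lam ->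
  (mu (front p gamma M up x t L k (idx k z) `&` G (lam + K * N)%R)
     <= (omega * M%:R ^+ 2)%:E * mu (cell idx k (idx k z)))%E.
Proof.
move=> Oz /negP; rewrite -leNgt => good.
have csub := center_sub p_gt1 gamma_ge0 gamma_lt_alpha alpha_lt1 L_gt0 M_gap (k := k) Oz.
(* The increment K N is spent in two halves, one on the back to get c <= lam + K N / 2, one on the
   front to reach c + K N / 2 <= lam + K N. Hence K / 2 in [omega]. *)
have [c /(_ (K / 2))[|Hf Hb]] := osc_weak (lk0 k) csub; first by rewrite divr_gt0.
set i := idx k z in good csub Hf Hb *.
have bsub : cell idx k (sh k i) `<=` back p gamma M up x t L k i.
  exact: (delay_back p_gt1 gamma_ge0 gamma_lt_alpha alpha_lt1 L_gt0 M_gap).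
have bP : back p gamma M up x t L k i `<=` prect p x t L.
  by apply: subset_trans csub; exact: half_prect.
have fP : front p gamma M up x t L k i `<=` prect p x t L.
  by apply: subset_trans csub; exact: half_prect.
have cP := subset_trans bsub bP.
(* Otherwise [g] < c - K N / 2 on D^- outside [G lam], which by [K_osc] is at most a quarter of D^-.
   A good cell has at most half of D^- inside [G lam], and 1/4 + 1/2 < 1. *)
have clam : c - K / 2 * N <= lam.
  rewrite leNgt; apply/negP => lamc.
  set D := cell _ _ _ in good bsub cP *.
  have muD : (mu D = mu (D `\` G lam) + mu (D `&` G lam))%E.
    by apply: measureDI; [exact: mcell|exact: mG].
  have H2 : (mu (D `\` G lam) <= (4^-1)%:E * mu D)%E.
    apply: (@le_trans _ _ (omega%:E * mu (back p gamma M up x t L k i))%E).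
      apply: le_trans Hb; apply: le_measure; rewrite ?inE.
      - by apply: measurableD; [exact: mcell|exact: mG].
      - by apply: measurable_lt => //; exact: measurable_half.
      move=> w [Dw nG]; split; first exact: bsub.
      rewrite /= (le_lt_trans _ lamc)// leNgt; apply/negP => gw; apply: nG.
      by split=> //; exact: cP.
    apply: (@le_trans _ _ (omega%:E * ((M%:R ^+ 2)%:E * mu D))%E).
      by rewrite lee_wpmul2l ?lee_fin// mu_half_cell.
    by rewrite muleA -EFinM lee_wpmul2r ?lee_fin.
  have := leeD H2 good; rewrite -muD /D mu_cell -!EFinM -EFinD lee_fin.
  have : 0 < (2 * l k) ^+ n * tau k 
    by apply: mulr_gt0 => //; apply: exprn_gt0; have := lk0 k; lra.
  exact: three_quarters_lt.
apply: (@le_trans _ _ (omega%:E * mu (front p gamma M up x t L k i))%E).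
  apply: le_trans Hf; apply: le_measure; rewrite ?inE.
  - by apply: measurableI => //; exact: measurable_half.
  - by apply: measurable_gt => //; exact: measurable_half.
  move=> w [Fw [Pw /= gw]]; split=> //=; apply: le_lt_trans gw.
  by lra.
by rewrite EFinM -muleA lee_wpmul2l ?lee_fin// mu_half_cell.
Qed.

(** The set where [g] > K N has at most the fraction K^-q of R^+(gamma), and R^+(gamma) has at most
    M^(n + time_exp 0) times the measure of a cell of generation 0. [K_top] brings the product below
    one half. *)
Lemma top_good z lam : K * N <= lam -> Om z -> ~ bad_cell 0 (idx 0 z) lam.
Proof.
move=> KNlam Oz /(bad_anti mcell mG G_anti KNlam).
rewrite /bad_cell /bad ltNge => /negP; apply.
set D := cell _ _ _.
have DU : D `<=` half_rect up p gamma x t L.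
  exact: (delay_region p_gt1 gamma_ge0 gamma_lt_alpha alpha_lt1 L_gt0 M_gap Oz).
have UP : half_rect up p gamma x t L `<=` prect p x t L by exact: half_prect.
apply: (@le_trans _ _ (mu (half_rect up p gamma x t L `&` [set z | K * N < g z])%R)).
  apply: le_measure; rewrite ?inE.
  - by apply: measurableI; [exact: mcell|exact: mG].
  - by apply: measurable_gt => //; exact: measurable_half.
  by move=> w [/DU ? [_ ?]].
apply: le_trans (osc_top K_gt0) _.
have KK : K `^ (- q) <= omega.
  rewrite !powRN lef_pV2 ?posrE ?powR_gt0 ?divr_gt0//.
  rewrite ge0_ler_powR ?nnegrE ?(ltW q_gt0) ?(ltW K_gt0) ?divr_ge0 ?(ltW K_gt0)//.
  by have h := K_gt0; lra.
rewrite lebesgue_half ?(ltW L_gt0) ?(ltW gamma_lt1)// /D mu_cell -!EFinM lee_fin.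
have -> : (2 * L) ^+ n = M%:R ^+ n * (2 * l 0) ^+ n.
  by rewrite [in LHS](sideE L M_gt1 0) expr1 mulrCA exprMn.
rewrite (step0E p L M_gt1).
set a := (2 * l 0) ^+ n; set b := tau 0.
have a0 : 0 <= a by apply: exprn_ge0; have := lk0 0; lra.
have b0 : 0 <= b by exact: ltW (tau0 0).
clearbody a b; have Ktop := K_top; move: (time_exp p 0) Ktop => e0 Ktop.
have Mn0 m : 0 <= M%:R ^+ m :> R by exact: exprn_ge0.
have [h1 h2] : 0 <= 1 - gamma /\ 1 - gamma <= 1.
  by split; [rewrite subr_ge0 ltW|rewrite gerBl].
apply: (@le_trans _ _ (omega * (M%:R ^+ (n + e0) * (a * b)))); last first.
  by rewrite mulrA; apply: ler_wpM2r; [exact: mulr_ge0|exact: Ktop].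
apply: ler_pM; [exact: powR_ge0| |exact: KK|].
  by rewrite !mulr_ge0.
rewrite exprD.
have -> : M%:R ^+ n * a * ((1 - gamma) * (M%:R ^+ e0 * b)) =
  (1 - gamma) * (M%:R ^+ n * M%:R ^+ e0 * (a * b)) by ring.
by rewrite ler_piMl// !mulr_ge0.
Qed.

Let C1_ge0 : 0 <= C1.
Proof. by rewrite addr_ge0 ?mulr_ge0 ?exprn_ge0. Qed.

Let C4_ge0 : 0 <= C4.
Proof. by rewrite !mulr_ge0 ?exprn_ge0 ?powR_ge0. Qed.

Let eta_ge0 : 0 <= omega * M%:R ^+ 2.
Proof. by rewrite mulr_ge0 ?exprn_ge0. Qed.

Let KN_gt0 : 0 < K * N. Proof. exact: mulr_gt0. Qed.

Let decay lam : K * N <= lam ->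
  (mu (excess_set (lam + K * N)%R) <= theta%:E * mu (excess_set lam))%E.
Proof.
move=> KNlam.
apply: (@le_trans _ _
  ((2 * C1 * (omega * M%:R ^+ 2) * C4)%:E * mu (excess_set lam))%E).
  apply: (@excess_decay _ _ _ mu _ idx idxS mcell sh (dilate p gamma M up x t L) G
    (front p gamma M up x t L) Om (K * N) _ C1 C4) => //.
  - by move=> k; exact: delay_inj.
  - by move=> k i; exact: measurable_dilate.
  - by move=> k i; exact: measurable_half.
  - exact: region_saturated.
  - exact: ltW.
  - exact: (mu_dilate up x t p_gt1 gamma_ge0 gamma_lt_alpha alpha_lt1 L_gt0 M_gap).
  - exact: (cell_dilate p_gt1 gamma_ge0 gamma_lt_alpha alpha_lt1 L_gt0 M_gap).
  - exact: osc_good.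
  - exact: (delay_front p_gt1 gamma_ge0 gamma_lt_alpha alpha_lt1 L_gt0 M_gap).
  - exact: (mu_parent up x t p_gt1 gamma_ge0 alpha_lt1 L_gt0 M_gap).
  - by move=> z; exact: top_good.
by rewrite lee_wpmul2r ?lee_fin.
Qed.

Let excess_pow j : (mu (excess_set (K * N + j%:R * (K * N))%R)
  <= (theta ^+ j)%:E * mu (excess_set (K * N)%R))%E.
Proof.
elim: j => [|j IH]; first by rewrite mul0r addr0 expr0 mul1e.
have -> : K * N + j.+1%:R * (K * N) = K * N + j%:R * (K * N) + K * N.
  by rewrite -natr1; ring.
apply: le_trans (decay _) _.
  by rewrite lerDl mulr_ge0 ?(ltW KN_gt0).
by rewrite exprS EFinM -muleA lee_wpmul2l ?lee_fin.
Qed.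

(** Two of the j + 2 levels yield no decay: the iteration can start only at K N, where [top_good]
    begins to hold, and the passage from level sets to excess sets costs another K N. *)
Lemma weak_john_nirenberg j :
  (mu (half_rect up p alpha x t L `&` [set z | j.+2%:R * (K * N) < g z])%R <=
   (2 * C1 * theta ^+ j)%:E *
     mu (half_rect up p gamma x t L `&` [set z | K * N < g z])%R)%E.
Proof.
set lam := K * N + j%:R * (K * N).
have jlam : j.+2%:R * (K * N) = lam + K * N by rewrite /lam -!natr1; ring.
have mhalf b : measurable (half_rect up p b x t L) by exact: measurable_half.
have aP : half_rect up p alpha x t L `<=` prect p x t L.
  by apply: half_prect; have h := gamma_ge0; have h' := gamma_lt_alpha; lra.
have gP : half_rect up p gamma x t L `<=` prect p x t L by exact: half_prect.
have mex lam' : measurable (excess_set lam').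
  by apply: measurable_excess => //; exact: region_saturated.
have mOm : measurable Om.
  exact: (measurable_region p up x t gamma_ge0 alpha_lt1 L_gt0 M_gap).
have cover : mu ((Om `&` G (lam + K * N)%R) `\` excess_set lam) = 0%E.
  apply: (@excess_cover _ _ _ mu _ idx mcell sh G (front p gamma M up x t L) Om
    (K * N) (omega * M%:R ^+ 2)) => //.
  - by move=> k i; exact: measurable_half.
  - exact: region_saturated.
  - by apply: le_lt_trans K_osc _; lra.
  - exact: osc_good.
  - exact: (cell_front p_gt1 gamma_ge0 gamma_lt_alpha alpha_lt1 L_gt0 M_gap).
  - exact: (region_fin up x t p_gt1 gamma_ge0 gamma_lt_alpha alpha_lt1 L_gt0 M_gap).
  - exact: region_approximate.
have init : (mu (excess_set (K * N)%R) <= (2 * C1)%:E *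
    mu (half_rect up p gamma x t L `&` [set z | K * N < g z])%R)%E.
  apply: le_trans (excess_init idxS mcell (Dil := dilate p gamma M up x t L) (C1 := C1)
     (U := half_rect up p gamma x t L) _ _ mG _ _ _ _ _ _ _) _ => //.
  - by move=> k; exact: delay_inj.
  - by move=> k i; exact: measurable_dilate.
  - exact: region_saturated.
  - exact: (mu_dilate up x t p_gt1 gamma_ge0 gamma_lt_alpha alpha_lt1 L_gt0 M_gap).
  - exact: (cell_dilate p_gt1 gamma_ge0 gamma_lt_alpha alpha_lt1 L_gt0 M_gap).
  - move=> k z; exact: (delay_region p_gt1 gamma_ge0 gamma_lt_alpha alpha_lt1 L_gt0 M_gap).
  rewrite lee_wpmul2l ?lee_fin ?mulr_ge0//.
  apply: le_measure; rewrite ?inE.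
  - by apply: measurableI.
  - exact: measurable_gt.
  by move=> z [? [_ ?]].
have bound : (mu (half_rect up p alpha x t L `&` [set z | j.+2%:R * (K * N) < g z])%R
    <= mu (excess_set lam))%E.
  apply: (@le_trans _ _ (mu (excess_set lam `|` (((Om `&` G (lam + K * N)%R) `\` excess_set lam)
      `|` (half_rect up p alpha x t L `\` Om))))).
    apply: le_measure; rewrite ?inE.
    - exact: measurable_gt.
    - apply: measurableU => //; apply: measurableU; apply: measurableD => //.
      exact: measurableI.
    move=> z [az gz]; have [Oz|Oz] := pselect (Om z); last by right; right.
    have [ez|ez] := pselect (excess_set lam z); first by left.
    by right; left; split=> //; split=> //; split; [exact: aP|rewrite /= -jlam].
  have m1 : measurable ((Om `&` G (lam + K * N)%R) `\` excess_set lam).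
    by apply: measurableD => //; exact: measurableI.
  have m2 : measurable (half_rect up p alpha x t L `\` Om) by exact: measurableD.
  have null : (mu (((Om `&` G (lam + K * N)%R) `\` excess_set lam)
      `|` (half_rect up p alpha x t L `\` Om)) <= 0)%E.
    apply: le_trans (measureU2 _ m1 m2) _; rewrite -[leRHS]adde0.
    apply: leeD; rewrite le_eqVlt; apply/orP; left; apply/eqP; first exact: cover.
    exact: (region_cover p up x t gamma_ge0 alpha_lt1 L_gt0 M_gap).
  apply: le_trans (measureU2 _ (mex lam) (measurableU _ _ m1 m2)) _.
  by rewrite -[leRHS]adde0; apply: leeD.
apply: le_trans bound _; apply: le_trans (excess_pow j) _.
have -> : 2 * C1 * theta ^+ j = theta ^+ j * (2 * C1) by rewrite mulrC.
rewrite [in leRHS]EFinM -muleA lee_wpmul2l ?lee_fin ?exprn_ge0//.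
Qed.

End weak_john_nirenberg.

(** * From level sets to integrals *)

Lemma powR_inv_solve (R : realType) (q W : R) : 0 < q -> 0 < W ->
  exists2 k : R, 0 < k & k `^ (- q) * W = 1.
Proof.
move=> q0 W0; exists (W `^ q^-1); first exact: powR_gt0.
rewrite -powRrM mulrN mulVf ?gt_eqF// powRN powRr1 ?(ltW W0)//.
by rewrite mulVf// gt_eqF.
Qed.

Section integral_estimates.
Context d (X : measurableType d) (R : realType).
Variable mu : {measure set X -> \bar R}.

Lemma level_le_integral (D S : set X) (h : X -> R) (v : R) :
  measurable D -> measurable S -> S `<=` D -> measurable_fun D h ->
  (forall z, D z -> 0 <= h z) -> 0 <= v -> (forall z, S z -> v <= h z) ->
  (v%:E * mu S <= \int[mu]_(z in D) (h z)%:E)%E.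
Proof.
move=> mD mS SD mh h0 v0 Sv.
have mhE : measurable_fun D (fun z => (h z)%:E) by exact/measurable_EFinP.
apply: (@le_trans _ _ (\int[mu]_(z in S) (h z)%:E)%E); last first.
  by apply: ge0_subset_integral => // z Dz; rewrite lee_fin h0.
rewrite -integral_cst//; apply: ge0_le_integral => //.
- exact: measurable_funS mhE.
Qed.

(** Where h <= 2 B, h^r <= (2 B)^(r - q) h^q. On the layer from (j + 2) B to (j + 3) B, h^r is at
    most 3^r 2^(r j) B^r; the decay 2^(-r j) 2^-j absorbs the growth and leaves a series of sum 2.
    Chebyshev at height B supplies the integral of h^q. *)
Lemma layer_cake (D U : set X) (h : X -> R) (q r B C : R) :
  measurable D -> measurable U -> D `<=` U -> measurable_fun U h ->
  (forall z, U z -> 0 <= h z) -> 0 < q -> q <= r -> 0 < B -> 0 <= C ->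
  (forall j, (mu (D `&` [set z | j.+2%:R * B < h z])%R <=
     (C * (2 `^ (- r) / 2) ^+ j)%:E * mu (U `&` [set z | B < h z])%R)%E) ->
  (\int[mu]_(z in U) (h z `^ q)%:E)%E \is a fin_num ->
  (\int[mu]_(z in D) (h z `^ r)%:E <=
   ((2 `^ (r - q) + 3 `^ r * C * 2) * B `^ (r - q))%:E *
     \int[mu]_(z in U) (h z `^ q)%:E)%E.
Proof.
move=> mD mU DU mh h0 q0 qr B0 C0 Hj Ifin.
set J := (\int[mu]_(z in U) (h z `^ q)%:E)%E in Ifin *.
have r0 : 0 <= r by apply: le_trans qr; exact: ltW.
have mhD : measurable_fun D h := measurable_funS mU DU mh.
have mpow s (A : set X) : measurable_fun A h -> measurable_fun A (fun z => h z `^ s).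
  by move=> mA; apply: (measurableT_comp (measurable_powR s)).
have mpowE s (A : set X) : measurable_fun A h -> measurable_fun A (fun z => (h z `^ s)%:E).
  by move=> mA; apply/measurable_EFinP; exact: mpow.
pose S j := D `&` [set z | j.+2%:R * B < h z].
have mS j : measurable (S j) by exact: measurable_superlevel.
pose a j : R := (j.+3%:R * B) `^ r.
have a0 j : 0 <= a j by exact: powR_ge0.
have J0 : (0 <= J)%E by apply: integral_ge0 => z _; rewrite lee_fin powR_ge0.
have mser : measurable_fun D (fun z => (\sum_(0 <= j <oo) (a j * \1_(S j) z)%:E)%E).
  apply: ge0_emeasurable_sum => //.
    by move=> j z _ _; rewrite lee_fin mulr_ge0.
  move=> j _; apply/measurable_EFinP; apply: measurable_funM => //.
have ser0 z : (0 <= \sum_(0 <= j <oo) (a j * \1_(S j) z)%:E)%E.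
  by apply: nneseries_ge0 => j _ _; rewrite lee_fin mulr_ge0.
have mlow : measurable_fun D (fun z => ((2 * B) `^ (r - q))%:E * (h z `^ q)%:E)%E.
  by apply: emeasurable_funM => //; exact: mpowE.
have low0 z : (0 <= ((2 * B) `^ (r - q))%:E * (h z `^ q)%:E)%E.
  by rewrite -EFinM lee_fin mulr_ge0 ?powR_ge0.
apply: (@le_trans _ _ (\int[mu]_(z in D) (((2 * B) `^ (r - q))%:E * (h z `^ q)%:E
    + \sum_(0 <= j <oo) (a j * \1_(S j) z)%:E))%E).
  apply: ge0_le_integral => //.
  - by move=> z _; rewrite lee_fin powR_ge0.
  - exact: mpowE.
  - exact: emeasurable_funD.
  move=> z Dz; have hz := h0 z (DU z Dz).
  have [h2B|h2B] := leP (h z) (2 * B).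
    rewrite -[leLHS]adde0; apply: leeD => //.
    rewrite -EFinM lee_fin.
    have -> : h z `^ r = h z `^ (r - q) * h z `^ q.
      have [hz0|hz0] := eqVneq (h z) 0; last by rewrite -powRD ?subrK// hz0 implybT.
      have qn0 : q != 0 by rewrite gt_eqF.
      have rn0 : r != 0 by rewrite gt_eqF// (lt_le_trans q0).
      by rewrite hz0 (powR0 rn0) (powR0 qn0) mulr0.
    rewrite ler_wpM2r ?powR_ge0// ge0_ler_powR ?nnegrE ?subr_ge0//.
    by rewrite mulr_ge0// ltW.
  have ex : exists j : nat, h z <= j.+3%:R * B.
    exists (Num.truncn (h z / B)).
    rewrite -ler_pdivrMr// ltW// (lt_le_trans (truncnS_gt _))// ler_nat.
    by rewrite (leq_trans (leqnSn _))// leqnSn.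
  (* Minimality of j gives (j + 2) B < h z; for j = 0 this is the case hypothesis. *)
  case: (ex_minnP ex) => j hj mini.
  have Sj : S j z.
    split=> //=; case: j hj mini => [//|j] hj mini.
    rewrite ltNge; apply/negP => hj'.
    by have := mini _ hj'; rewrite ltnn.
  rewrite -[leLHS]add0e; apply: leeD => //.
  apply: (@le_trans _ _ (\sum_(0 <= i < j.+1) (a i * \1_(S i) z)%:E)%E); last first.
    by apply: nneseries_lim_ge => i _ _; rewrite lee_fin mulr_ge0.
  rewrite big_nat_recr//= -[leLHS]add0e; apply: leeD.
    by apply: sume_ge0 => i _; rewrite lee_fin mulr_ge0.
  rewrite lee_fin indicE mem_set// mulr1 ge0_ler_powR ?nnegrE//.
  by rewrite mulr_ge0// ltW.
rewrite ge0_integralD//.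
rewrite [in leRHS]mulrDl [in leRHS]EFinD ge0_muleDl ?lee_fin ?mulr_ge0 ?powR_ge0//; apply: leeD.
  rewrite ge0_integralZl_EFin ?powR_ge0//; last first.
  - exact: mpowE.
  - by move=> z _; rewrite lee_fin powR_ge0.
  rewrite powRM ?(ltW B0)// lee_wpmul2l ?lee_fin ?mulr_ge0 ?powR_ge0//.
  apply: ge0_subset_integral => //; first exact: mpowE.
  by move=> z _; rewrite lee_fin powR_ge0.
rewrite integral_nneseries//; last 2 first.
- by move=> j; apply/measurable_EFinP; apply: measurable_funM.
- by move=> j z _; rewrite lee_fin mulr_ge0.
have BJ : ((B `^ q)%:E * mu (U `&` [set z | (B < h z)%R]) <= J)%E.
  apply: level_le_integral => //.
  - exact: measurable_superlevel.
  - exact: mpow.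
  - by move=> z Uz; exact: powR_ge0.
  - exact: powR_ge0.
  - move=> z [Uz /= Bz]; rewrite ge0_ler_powR ?nnegrE ?(ltW B0) ?(ltW q0) ?(ltW Bz)//.
    exact: h0.
move: Ifin BJ => /fineK <-; set I := fine J => BJ.
have I0 : 0 <= I by exact: fine_ge0.
(* The final factor 2 makes the j-th term e / 2^(j+1), the form summed by [epsilon_trick], here over
   the zero series. *)
pose e := 3 `^ r * C * B `^ (r - q) * I * 2.
have e0 : 0 <= e by rewrite !mulr_ge0 ?powR_ge0.
apply: (@le_trans _ _ (\sum_(0 <= j <oo) (0 + (e / (2 ^ j.+1)%:R)%:E))%E).
  apply: lee_nneseries => [j _ _|j _].
    by apply: integral_ge0 => z _; rewrite lee_fin mulr_ge0.
  under eq_integral do rewrite EFinM.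
  rewrite ge0_integralZl_EFin//; last by apply/measurable_EFinP.
  rewrite integral_indic// setIidl; last by move=> z [].
  apply: (@le_trans _ _ ((a j)%:E * ((C * (2 `^ (- r) / 2) ^+ j)%:E *
      mu (U `&` [set z | (B < h z)%R])))%E).
    by rewrite lee_wpmul2l ?lee_fin//; exact: Hj.
  have aj : a j <= 3 `^ r * (2 `^ r) ^+ j * (B `^ (r - q) * B `^ q).
    have -> : B `^ (r - q) * B `^ q = B `^ r.
      by rewrite -powRD ?subrK ?(gt_eqF B0) ?implybT.
    rewrite /a powRM ?(ltW B0)// ler_wpM2r ?powR_ge0//.
    have -> : 3 `^ r * (2 `^ r) ^+ j = (3 * 2 ^+ j) `^ r :> R.
      rewrite powRM ?exprn_ge0//; congr (_ * _).
      by rewrite -powR_mulrn ?powR_ge0// -powRrM mulrC powRrM powR_mulrn.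
    rewrite ge0_ler_powR ?nnegrE ?mulr_ge0 ?exprn_ge0//.
    rewrite -natrX -natrM ler_nat.
    elim: (j) => // m IH; rewrite expnS mulnCA; apply: leq_trans (leq_mul (leqnn 2) IH).
    by rewrite mul2n -addnn addSn ltnS leq_addl.
  have : (0 <= mu (U `&` [set z | (B < h z)%R]))%E by [].
  move: (mu _) BJ => m BJ m0.
  have Bq0 : 0 < B `^ q by exact: powR_gt0.
  have mfin : m \is a fin_num.
    rewrite ge0_fin_numE// ltey; apply/eqP => moo; move: BJ.
    by rewrite moo gt0_muley ?lte_fin// leNgt ltry.
  move: BJ m0; rewrite -(fineK mfin); set m' := fine m.
  rewrite add0e -!EFinM !lee_fin => BJ m0.
  have c0 : 0 <= C * (2 `^ (- r) / 2) ^+ j * m'.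
    by rewrite !mulr_ge0 ?exprn_ge0 ?mulr_ge0 ?powR_ge0.
  apply: (le_trans (ler_wpM2r c0 aj)).
  have -> : 3 `^ r * (2 `^ r) ^+ j * (B `^ (r - q) * B `^ q) *
      (C * (2 `^ (- r) / 2) ^+ j * m') =
    3 `^ r * C * B `^ (r - q) * ((2 `^ r * (2 `^ (- r) / 2)) ^+ j) * (B `^ q * m').
    rewrite [in RHS]exprMn.
    by move: (_ ^+ j) ((_ / _) ^+ j) => u w; ring.
  have -> : 2 `^ r * (2 `^ (- r) / 2) = 2^-1 :> R.
    by rewrite mulrA powRN divff ?mul1r// gt_eqF// powR_gt0.
  have -> : e / (2 ^ j.+1)%:R = 3 `^ r * C * B `^ (r - q) * (2^-1) ^+ j * I.
    rewrite /e natrX exprS invfM exprVn -!mulrA; congr (_ * _); congr (_ * _).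
    by congr (_ * _); rewrite mulrCA; field.
  by rewrite ler_wpM2l ?mulr_ge0 ?powR_ge0 ?exprn_ge0.
apply: le_trans (epsilon_trick _ _ e0) _ => //.
rewrite eseries0// add0e -EFinM lee_fin /e.
by rewrite le_eqVlt; apply/orP; left; apply/eqP; ring.
Qed.

End integral_estimates.

(** * Weak-type bounds from the oscillation *)

Section oscillation.
Variables (R : realType) (n : nat).
Local Notation X := (spacetime R n).
Local Notation mu := (lebesgue R n).
Implicit Types (f h : X -> R) (x y : n.-tuple R) (p gamma q s t l c N k : R).

Definition signed (up : bool) h (z : X) : R := Num.max (time_sign R up * h z) 0.

Lemma signed_pos h : h^\+ = signed true h.
Proof. by apply/funext => z; rewrite /signed /time_sign mul1r. Qed.

Lemma signed_neg h : h^\- = signed false h.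
Proof. by apply/funext => z; rewrite /signed /time_sign mulN1r. Qed.

Lemma signed_ge0 up h z : 0 <= signed up h z.
Proof. by rewrite /signed le_max lexx orbT. Qed.

Lemma lt_signed up h z v : 0 <= v -> (v < signed up h z) = (v < time_sign R up * h z).
Proof. by move=> v0; rewrite /signed lt_max [v < 0]ltNge v0 orbF. Qed.

Lemma measurable_signed up h c (A : set X) : measurable_fun A h ->
  measurable_fun A (signed up (h \- cst c)).
Proof.
move=> mh; have mhc : measurable_fun A (h \- cst c).
  by apply: measurable_funB => //; exact: measurable_cst.
apply: measurable_maxr; last exact: measurable_cst.
by apply: measurable_funM => //; exact: measurable_cst.
Qed.

Lemma measurable_signed_pow up h c s (A : set X) : measurable_fun A h ->
  measurable_fun A (fun z => signed up (h \- cst c) z `^ s).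
Proof.
by move=> mh; apply: (measurableT_comp (measurable_powR s)); exact: measurable_signed.
Qed.

Lemma mu_half_gt0 p gamma y s l : 0 < l -> gamma < 1 ->
  0 < (2 * l) ^+ n * ((1 - gamma) * l `^ p).
Proof.
by move=> l0 g1; rewrite !mulr_gt0 ?exprn_gt0 ?mulr_gt0 ?subr_gt0 ?powR_gt0.
Qed.

Lemma oscE p gamma q y s l f c : osc p gamma q y s l f c =
  ((avg (half_rect true p gamma y s l) (fun z => signed true (f \- cst c) z `^ q)%R
   + avg (half_rect false p gamma y s l) (fun z => signed false (f \- cst c) z `^ q)%R)
   `^ q^-1)%E.
Proof. by rewrite /osc signed_pos signed_neg. Qed.

Lemma avg_ge0 (A : set X) h : (forall z, 0 <= h z) -> (0 <= avg A h)%E.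
Proof.
move=> h0; rewrite /avg mule_ge0 ?lee_fin ?invr_ge0 ?fine_ge0//.
by apply: integral_ge0 => z _; rewrite lee_fin.
Qed.

Lemma osc_halves p gamma q y s l f c N up : 0 < q -> 0 < N -> 0 < l -> gamma < 1 ->
  (osc p gamma q y s l f c < N%:E)%E ->
  (\int[mu]_(z in half_rect up p gamma y s l) (signed up (f \- cst c)%R z `^ q)%:E
     <= (N `^ q)%:E * mu (half_rect up p gamma y s l))%E.
Proof.
move=> q0 N0 l0 g1; rewrite oscE => oscN.
set A := half_rect up p gamma y s l.
have H : (avg A (fun z => signed up (f \- cst c) z `^ q)%R <= (N `^ q)%:E)%E.
  set a := avg _ _ in oscN; set b := avg (half_rect false _ _ _ _ _) _ in oscN.
  have a0 : (0 <= a)%E by apply: avg_ge0 => z; exact: powR_ge0.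
  have b0 : (0 <= b)%E by apply: avg_ge0 => z; exact: powR_ge0.
  have ab : (a + b <= (N `^ q)%:E)%E.
    rewrite leNgt; apply/negP => abN; move: oscN; rewrite ltNge => /negP; apply.
    have -> : N%:E = ((N `^ q)%:E `^ q^-1)%E.
      by rewrite poweR_EFin -powRrM mulfV ?gt_eqF// powRr1// ltW.
    apply: gt0_ler_poweR.
    - by rewrite invr_ge0 ltW.
    - by rewrite in_itv/= leey andbT lee_fin powR_ge0.
    - by rewrite in_itv/= leey andbT adde_ge0.
    - exact: ltW.
  apply: le_trans ab; rewrite /A; case: up @A => A.
    by rewrite leeDl.
  by rewrite leeDr.
move: H; rewrite /avg {1}/A lebesgue_half ?(ltW l0) ?(ltW g1)//=.
rewrite lee_pdivrMl; last exact: mu_half_gt0.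
by rewrite [X in (_ <= X)%E]muleC.
Qed.

(** Chebyshev at height k N. The factor N^q cancels, so the bound depends on k alone; this
    invariance under scaling of [f] allows constants that do not depend on it. *)
Lemma osc_weak_type p gamma q y s l f c N up k : 0 < q -> 0 < N -> 0 < l ->
  gamma < 1 -> measurable_fun (half_rect up p gamma y s l) f ->
  (osc p gamma q y s l f c < N%:E)%E -> 0 < k ->
  (mu (half_rect up p gamma y s l `&` [set z | k * N < time_sign R up * (f z - c)])%R
     <= (k `^ (- q))%:E * mu (half_rect up p gamma y s l))%E.
Proof.
move=> q0 N0 l0 g1 mf oscN k0.
have := osc_halves up q0 N0 l0 g1 oscN.
set A := half_rect up p gamma y s l in mf *.
have mA : measurable A by exact: measurable_half.
set S := A `&` _.
have kN0 : 0 <= k * N by rewrite mulr_ge0// ltW.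
have SE : S = A `&` [set z | k * N < signed up (f \- cst c) z].
  by apply/seteqP; split=> z [Az kz]; split=> //; move: kz; rewrite /= lt_signed.
have mS : measurable S.
  by rewrite SE; apply: measurable_superlevel => //; exact: measurable_signed.
move=> HI.
have : (((k * N) `^ q)%:E * mu S <= (N `^ q)%:E * mu A)%E.
  apply: le_trans _ HI.
  apply: (@level_le_integral _ X R mu A S (fun z => signed up (f \- cst c) z `^ q)).
  - exact: mA.
  - exact: mS.
  - by move=> z [].
  - exact: measurable_signed_pow.
  - by move=> z _; exact: powR_ge0.
  - exact: powR_ge0.
  - rewrite SE => z [_ /= kz]; rewrite ge0_ler_powR ?nnegrE ?(ltW q0) ?(ltW kz)//.
    exact: signed_ge0.
rewrite powRM ?(ltW k0) ?(ltW N0)// mulrC EFinM -muleA.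
rewrite lee_pmul2l ?fin_num_fun// ?lte_fin ?powR_gt0//.
by rewrite powRN lee_pdivlMl// powR_gt0.
Qed.

End oscillation.

Section zero_oscillation.
Variables (R : realType) (n : nat) (p gamma q s l : R) (y : n.-tuple R).
Variable f : spacetime R n -> R.
Local Notation X := (spacetime R n).
Local Notation mu := (lebesgue R n).
Local Notation sgn up := (time_sign R up).
Local Notation H up := (half_rect up p gamma y s l).

(* With oscillation zero the level sets have no scale.  Here c is the essential supremum
   of f on the upper half, which cannot exceed its essential infimum on the lower one. *)
Lemma zero_oscillation : 0 < q -> 0 < l -> 0 <= gamma -> gamma < 1 ->
  measurable_fun (prect p y s l) f ->
  (forall N, 0 < N -> exists c, (osc p gamma q y s l f c < N%:E)%E) ->
  exists c, forall up, mu (H up `&` [set z | 0 < sgn up * (f z - c)]) = 0%E.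
Proof.
move=> q0 l0 g0 g1 mf small.
have mH up : measurable (H up) by exact: measurable_half.
have mfH up : measurable_fun (H up) f.
  by apply: measurable_funS mf; [exact: measurable_prect|exact: half_prect].
pose m0 : R := (2 * l) ^+ n * ((1 - gamma) * l `^ p).
have m00 : 0 < m0 by exact: mu_half_gt0.
have muH up : mu (H up) = m0%:E by rewrite lebesgue_half ?(ltW l0) ?(ltW g1).
pose S up a := H up `&` [set z | a < sgn up * f z].
have mS up a : measurable (S up a).
  apply: (@measurable_superlevel _ X R (H up) (fun z => sgn up * f z) a (mH up)).
  by apply: measurable_funM; [exact: measurable_cst|exact: mfH].
have Sfin up a : mu (S up a) \is a fin_num.
  rewrite ge0_fin_numE//; apply: (@le_lt_trans _ _ (mu (H up))).
    by apply: le_measure; rewrite ?inE// => z [].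
  by rewrite muH ltry.
have sep a b : (0 < mu (S true a))%E -> (0 < mu (S false b))%E -> a <= - b.
  move=> Sa Sb; rewrite leNgt; apply/negP => ba.
  (* Half the gap between the values [a] above and [- b] below: any constant c is at least [dl]
     under a or more than [dl] over - b. *)
  pose dl := (a + b) / 2; have dl0 : 0 < dl by rewrite /dl divr_gt0//; lra.
  pose e := Num.min (fine (mu (S true a))) (fine (mu (S false b))).
  have e0 : 0 < e by rewrite lt_min !fine_gt0// ?Sa ?Sb -?ge0_fin_numE ?Sfin.
  (* Then k^-q m0 = e / 2, below the measure of either level set. The oscillation is taken below
     [dl / k], so that the weak-type bound is tested at height exactly [dl]. *)
  have [|k k0 kW] := @powR_inv_solve R q (2 * m0 / e) q0.
    by rewrite divr_gt0// mulr_gt0.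
  have ke : k `^ (- q) * m0 < e.
    have : k `^ (- q) * m0 * 2 = e.
      transitivity (k `^ (- q) * (2 * m0 / e) * e); last by rewrite kW mul1r.
      by rewrite -[RHS]mulrA divfK ?gt_eqF//; ring.
    by have : 0 < k `^ (- q) * m0 by [rewrite mulr_gt0 ?powR_gt0]; lra.
  have N0 : 0 < dl / k by rewrite divr_gt0.
  have [c cN] := small _ N0.
  have W up := osc_weak_type q0 N0 l0 g1 (mfH up) cN k0.
  have kN : k * (dl / k) = dl by rewrite mulrC divfK// gt_eqF.
  have T up v : e <= fine (mu (S up v)) ->
      (forall z, v < sgn up * f z -> dl < sgn up * (f z - c)) -> False.
    move=> ev Sv; move: (W up); rewrite muH kN leNgt => /negP; apply.
    apply: (@lt_le_trans _ _ (mu (S up v))).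
      by rewrite -(fineK (Sfin up v)) -EFinM lte_fin; exact: lt_le_trans ev.
    apply: le_measure; rewrite ?inE//.
      apply: (@measurable_superlevel _ X R (H up) (fun z => sgn up * (f z - c)) dl).
        exact: mH.
      exact: measurable_affine.
    by move=> z [Hz /Sv].
  have [ca|ca] := leP (c + dl) a.
    apply: (T true a); first by rewrite ge_min lexx.
    by rewrite /time_sign => z; lra.
  apply: (T false b); first by rewrite ge_min lexx orbT.
  by move: ca; rewrite /dl /time_sign => ca z; lra.
(* The half is the union of its level sets at the heights -j, and it has positive measure. For [up]
   true this makes [E] nonempty; for [up] false, with [sep], it bounds [E] above. *)
have ex up : exists a, (0 < mu (S up a))%E.
  apply: contrapT => /forallNP none.
  have : mu (\bigcup_j S up (- j%:R)) = 0%E.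
    apply: measure0_bigcup => // j; apply/eqP; rewrite eq_le measure_ge0 andbT leNgt.
    exact/negP/none.
  suff -> : \bigcup_j S up (- j%:R) = H up.
    by rewrite muH => -[] m0E; move: m00; rewrite m0E ltxx.
  apply/seteqP; split=> [z [j _ []]//|z Hz].
  exists (Num.truncn (`|sgn up * f z|)).+1 => //; split=> //=.
  rewrite ltrNl; apply: le_lt_trans (truncnS_gt _).
  by rewrite -normrN ler_norm.
have [b0 Sb0] := ex false.
pose E := [set a | (0 < mu (S true a))%E].
have hE : has_sup E.
  by split; [exact: ex|exists (- b0) => a Ea; exact: sep].
have Snull up a : ~ (0 < mu (S up a))%E -> mu (S up a) = 0%E.
  by move=> /negP; rewrite -leNgt => h; apply/eqP; rewrite eq_le h measure_ge0.
exists (sup E) => up.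
have -> : H up `&` [set z | 0 < sgn up * (f z - sup E)] =
    \bigcup_j S up (sgn up * sup E + j.+1%:R^-1).
  apply/seteqP; split=> [z [Hz /= fz]|z [j _ [Hz /= fz]]].
    exists (Num.truncn (sgn up * (f z - sup E))^-1) => //; split=> //=.
    rewrite addrC -ltrBrDr -mulrBr -[ltRHS]invrK ltf_pV2 ?posrE ?invr_gt0//.
    exact: truncnS_gt.
  split=> //=; rewrite mulrBr subr_gt0; apply: lt_trans fz.
  by rewrite ltrDl.
apply: measure0_bigcup => // j; apply: Snull.
have j0 : 0 < j.+1%:R^-1 :> R by [].
case: up => Spos.
  have := sup_upper_bound hE Spos; rewrite /time_sign mul1r.
  by rewrite leNgt ltrDl j0.
have : sup E <= - (sgn false * sup E + j.+1%:R^-1).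
  by apply: ge_sup; [exact: hE.1|move=> a Ea; exact: sep].
by rewrite /time_sign mulN1r opprD opprK lerBrDr gerDl leNgt j0.
Qed.

End zero_oscillation.

(** [cR] is an argument and not produced here, because the same constant must serve both directions.
    [N] is any positive number for which each subrectangle admits a constant with oscillation below
    [N]. *)
Lemma half_rect_reverse_holder (R : realType) (n : nat) (p gamma alpha q r K N : R) (M : nat)
    (up : bool) (x : n.-tuple R) (t L cR : R) (f : spacetime R n -> R) :
  let theta := 2 `^ (- r) / 2 in
  let omega := (K / 2) `^ (- q) in
  let C1 : R := 2 * M%:R ^+ 2 + 2 in
  let C4 : R := M%:R ^+ n * M%:R `^ p * M%:R ^+ 2 in
  1 < p -> 0 <= gamma -> gamma < alpha -> alpha < 1 -> 0 < q -> q <= r -> 0 < L ->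
  3 < M%:R * (alpha - gamma) -> 0 < K -> 0 < N ->
  omega * M%:R ^+ 2 <= 4^-1 ->
  2 * C1 * (omega * M%:R ^+ 2) * C4 <= theta ->
  omega * M%:R ^+ (n + time_exp p 0) <= 2^-1 ->
  measurable_fun (prect p x t L) f ->
  (forall y s l, 0 < l -> prect p y s l `<=` prect p x t L ->
    exists c, (osc p gamma q y s l f c < N%:E)%E) ->
  (osc p gamma q x t L f cR < N%:E)%E ->
  (\int[lebesgue R n]_(z in half_rect up p alpha x t L)
      (signed up (f \- cst cR)%R z `^ r)%:E
   <= ((2 `^ (r - q) + 3 `^ r * (2 * C1) * 2) * (K * N) `^ (r - q))%:E *
      \int[lebesgue R n]_(z in half_rect up p gamma x t L)
        (signed up (f \- cst cR)%R z `^ q)%:E)%E.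
Proof.
move=> theta omega C1 C4 p1 g0 ga a1 q0 qr L0 Mgap K0 N0 H1 H2 H3 mf oscN oscR.
have g1 : gamma < 1 by lra.
pose g z := time_sign R up * (f z - cR).
have mg : measurable_fun (prect p x t L) g.
  exact: measurable_affine.
have mfh b y s l : prect p y s l `<=` prect p x t L ->
    measurable_fun (half_rect b p gamma y s l) f.
  move=> sub; apply: measurable_funS mf; first exact: measurable_prect.
  by apply: subset_trans sub; exact: half_prect.
have theta0 : 0 <= theta by rewrite divr_ge0 ?powR_ge0.
have osc_weak y s l : 0 < l -> prect p y s l `<=` prect p x t L ->
  exists c, forall k, 0 < k ->
    (lebesgue R n (half_rect up p gamma y s l `&` [set z | c + k * N < g z])%R
      <= (k `^ (- q))%:E * lebesgue R n (half_rect up p gamma y s l))%E /\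
    (lebesgue R n (half_rect (~~ up) p gamma y s l `&` [set z | g z < c - k * N])%R
      <= (k `^ (- q))%:E * lebesgue R n (half_rect (~~ up) p gamma y s l))%E.
  move=> l0 sub; have [c cN] := oscN y s l l0 sub.
  (* The constant of the subrectangle, transported by the same affine map that turns [f] into
     [g]. *)
  exists (time_sign R up * (c - cR)) => k k0; split.
    rewrite (_ : [set z | _ < g z] = [set z | k * N < time_sign R up * (f z - c)]).
      exact: (osc_weak_type q0 N0 l0 g1 (mfh up y s l sub) cN k0).
    apply/funext => z /=; rewrite -ltrBrDl /g -mulrBr.
    by rewrite (_ : f z - cR - (c - cR) = f z - c)//; ring.
  rewrite (_ : [set z | g z < _] = [set z | k * N < time_sign R (~~ up) * (f z - c)]).
    exact: (osc_weak_type q0 N0 l0 g1 (mfh (~~ up) y s l sub) cN k0).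
  apply/funext => z /=; rewrite time_signN ltrBrDl -ltrBrDr /g -mulrBr.
  by rewrite (_ : c - cR - (f z - cR) = - (f z - c)) ?mulrN ?mulNr//; ring.
have KN0 : 0 < K * N by exact: mulr_gt0.
have C10 : 0 <= C1 by rewrite addr_ge0 ?mulr_ge0 ?exprn_ge0.
have osc_top k : 0 < k -> (lebesgue R n (half_rect up p gamma x t L `&` [set z | k * N < g z])%R
     <= (k `^ (- q))%:E * lebesgue R n (half_rect up p gamma x t L))%E.
  by move=> k0; exact: (osc_weak_type q0 N0 L0 g1 (mfh _ _ _ _ (@subset_refl _ _)) oscR k0).
apply: (@layer_cake _ _ R (lebesgue R n) (half_rect up p alpha x t L)
  (half_rect up p gamma x t L) (signed up (f \- cst cR)) q r (K * N) (2 * C1)).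
- exact: measurable_half.
- exact: measurable_half.
- by apply: half_anti; exact: ltW.
- exact/measurable_signed/mfh.
- by move=> z _; exact: signed_ge0.
- exact: q0.
- exact: qr.
- exact: KN0.
- exact: mulr_ge0.
- move=> j.
  have := weak_john_nirenberg p1 g0 ga a1 L0 Mgap K0 N0 q0 theta0 mg H1 H2 H3 osc_weak osc_top j.
  have gS v : 0 <= v ->
      [set z | v < signed up (f \- cst cR) z] = [set z | v < g z].
    by move=> v0; apply/seteqP; split=> z; rewrite /= lt_signed.
  by rewrite !gS ?mulr_ge0 ?(ltW K0) ?(ltW N0).
- rewrite ge0_fin_numE; last by apply: integral_ge0 => z _; rewrite lee_fin powR_ge0.
  apply: le_lt_trans (osc_halves up q0 N0 L0 g1 oscR) _.
  by rewrite lebesgue_half ?(ltW L0) ?(ltW g1)// -EFinM ltry.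
Qed.

(** * Choice of the constants and the case of norm zero *)

Theorem corollary3p3 (R : realType) (n : nat) (p gamma alpha q r : R)
    (n_ge1 : (1 <= n)%N) (p_gt1 : 1 < p)
    (gamma_ge0 : 0 <= gamma) (gamma_lt1 : gamma < 1)
    (gamma_lt_alpha : gamma < alpha) (alpha_lt1 : alpha < 1)
    (q_gt0 : 0 < q) (q_le1 : q <= 1) (q_le_r : q <= r) :
  exists2 c : R, 0 < c &
    forall (x : n.-tuple R) (t L : R) (f : spacetime R n -> R),
      0 < L -> pbmo p gamma q x t L f ->
      exists cR : R,
        (\int[lebesgue R n]_(z in prect_up p alpha x t L)
            (((f \- cst cR)^\+ z) `^ r)%:E
         <= c%:E * (pbmo_norm p gamma q x t L f `^ (r - q)
            * \int[lebesgue R n]_(z in prect_up p gamma x t L)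
                (((f \- cst cR)^\+ z) `^ q)%:E))%E
        /\
        (\int[lebesgue R n]_(z in prect_lo p alpha x t L)
            (((f \- cst cR)^\- z) `^ r)%:E
         <= c%:E * (pbmo_norm p gamma q x t L f `^ (r - q)
            * \int[lebesgue R n]_(z in prect_lo p gamma x t L)
                (((f \- cst cR)^\- z) `^ q)%:E))%E.
Proof.
(* [M] and then [K] are fixed before the rectangle and [f] are introduced, so [c] depends only on n,
   p, q, r, gamma and alpha. *)
pose M := (Num.truncn (3 / (alpha - gamma))).+1.
have Mgap : 3 < M%:R * (alpha - gamma).
  by rewrite -ltr_pdivrMr ?subr_gt0// truncnS_gt.
pose theta : R := 2 `^ (- r) / 2.
have theta0 : 0 < theta by rewrite divr_gt0 ?powR_gt0.
pose C1 : R := 2 * M%:R ^+ 2 + 2.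
pose C4 : R := M%:R ^+ n * M%:R `^ p * M%:R ^+ 2.
pose m2 : R := M%:R ^+ 2.
pose mn : R := M%:R ^+ (n + time_exp p 0).
have M0 : 0 < M%:R :> R by rewrite ltr0n.
have m20 : 0 < m2 by exact: exprn_gt0.
have mn0 : 0 < mn by exact: exprn_gt0.
have C10 : 0 < C1 by rewrite /C1 -/m2; lra.
have C40 : 0 < C4.
  rewrite /C4 -/m2; apply: mulr_gt0 => //.
  by apply: mulr_gt0; [exact: exprn_gt0|exact: powR_gt0].
have D0 : 0 < 2 * C1 * m2 * C4 / theta.
  by apply: divr_gt0 => //; do 3 apply: mulr_gt0 => //.
(* Each summand is what one smallness condition asks of k^q: good cells, decay ratio [theta], top
   cells. Since the sum times k^-q is 1, each product is at most 1. *)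
have [|k k0 kW] := @powR_inv_solve R q (4 * m2 + 2 * C1 * m2 * C4 / theta + 2 * mn) q_gt0.
  by move: m20 mn0 D0; lra.
pose K := k * 2; have K0 : 0 < K by rewrite mulr_gt0.
have K2 : K / 2 = k by rewrite mulfK.
have w0 : 0 < k `^ (- q) by exact: powR_gt0.
have [W1 W2 W3] : [/\ k `^ (- q) * m2 <= 4^-1,
    2 * C1 * (k `^ (- q) * m2) * C4 <= theta & k `^ (- q) * mn <= 2^-1].
  have u1 : 0 < k `^ (- q) * (4 * m2) by apply: mulr_gt0 => //; exact: mulr_gt0.
  have u2 := mulr_gt0 w0 D0.
  have u3 : 0 < k `^ (- q) * (2 * mn) by apply: mulr_gt0 => //; exact: mulr_gt0.
  have kW' : k `^ (- q) * (4 * m2) + k `^ (- q) * (2 * C1 * m2 * C4 / theta)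
      + k `^ (- q) * (2 * mn) = 1 by rewrite -!mulrDr.
  split.
  - rewrite -[leRHS]mulr1 ler_pdivlMl// mulrCA -[leRHS]kW' -addrA lerDl.
    by apply: addr_ge0; exact: ltW.
  - have : k `^ (- q) * (2 * C1 * m2 * C4 / theta) <= 1.
      by rewrite -[leRHS]kW' addrAC lerDr; apply: addr_ge0; exact: ltW.
    rewrite mulrA ler_pdivrMr// mul1r; apply: le_trans.
    by rewrite le_eqVlt; apply/orP; left; apply/eqP; ring.
  - rewrite -[leRHS]mulr1 ler_pdivlMl// mulrCA -[leRHS]kW' lerDr.
    by apply: addr_ge0; exact: ltW.
(* The factor 2 next to [K] comes from the choice N = 2 ||f||. *)
pose c := (2 `^ (r - q) + 3 `^ r * (2 * C1) * 2) * (K * 2) `^ (r - q).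
have c0 : 0 < c.
  rewrite mulr_gt0 ?powR_gt0 ?mulr_gt0// addr_gt0 ?powR_gt0//.
  by rewrite !mulr_gt0 ?powR_gt0.
exists c => // x t L f L0 [[mf _] normfin].
set N := pbmo_norm p gamma q x t L f in normfin *.
have inf_le y s l : 0 < l -> prect p y s l `<=` prect p x t L ->
    (ereal_inf (range (osc p gamma q y s l f)) <= N)%E.
  by move=> l0 sub; apply: ereal_sup_ubound; exists y, s, l.
clearbody N; have N0 : (0 <= N)%E.
  apply: le_trans (inf_le x t L L0 (@subset_refl _ _)).
  by apply: le_ereal_inf_tmp => _ [b _ <-]; exact: poweR_ge0.
have NE : N = (fine N)%:E by rewrite fineK// ge0_fin_numE.
have oscN N1 : fine N < N1 -> forall y s l, 0 < l ->
    prect p y s l `<=` prect p x t L -> exists b, (osc p gamma q y s l f b < N1%:E)%E.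
  move=> NN1 y s l l0 sub.
  have /ereal_inf_lt[_ [b _ <-] bN] :
      (ereal_inf (range (osc p gamma q y s l f)) < N1%:E)%E.
    by apply: le_lt_trans (inf_le y s l l0 sub) _; rewrite NE lte_fin.
  by exists b.
(* If the norm is 0, twice the norm is not above it, and positive values of N would give constants
   varying with N. The constant of [zero_oscillation] makes both left-hand sides vanish, so it does
   not matter whether the power of 0 on the right is 0, or 1 when r = q. *)
have [N_eq0|N_neq0] := eqVneq (fine N) 0.
  have [|cR cR0] := zero_oscillation q_gt0 L0 gamma_ge0 gamma_lt1 mf.
    by move=> N1 N10; apply: oscN => //; rewrite N_eq0.
  exists cR; rewrite !signed_pos !signed_neg.
  have int0 up : (\int[lebesgue R n]_(z in half_rect up p alpha x t L)
      (signed up (f \- cst cR)%R z `^ r)%:E = 0)%E.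
    have ra : half_rect up p alpha x t L `<=` half_rect up p gamma x t L.
      by apply: half_anti; exact: ltW.
    have mfa : measurable_fun (half_rect up p alpha x t L) f.
      apply: measurable_funS mf; first exact: measurable_prect.
      by apply: subset_trans ra _; exact: half_prect.
    have mfg : measurable_fun (half_rect up p gamma x t L) f.
      by apply: measurable_funS mf; [exact: measurable_prect|exact: half_prect].
    rewrite (@ge0_ae_eq_integral _ _ _ (lebesgue R n) _ _ (cst 0%E)).
    - exact: integral0.
    - exact: measurable_half.
    - by apply/measurable_EFinP; exact: measurable_signed_pow.
    - exact: measurable_cst.
    - by move=> z _; rewrite lee_fin powR_ge0.
    - by [].
    - exists (half_rect up p gamma x t L `&`
        [set z | 0 < time_sign R up * (f z - cR)]); split.
      + apply: measurable_superlevel; first exact: measurable_half.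
        exact: measurable_affine.
      + exact: cR0.
      + move=> z /= /not_implyP[az nz]; split; first exact: ra.
        rewrite /= ltNge; apply/negP => fz; apply: nz.
        rewrite (_ : signed up (f \- cst cR) z = 0); last exact: max_r.
        (* Here r > 0 matters, since 0 to the power 0 is 1. *)
        by rewrite powR0// gt_eqF// (lt_le_trans q_gt0).
  split.
  - rewrite (int0 true) mule_ge0 ?lee_fin ?(ltW c0)// mule_ge0 ?poweR_ge0//.
    by apply: integral_ge0 => z _; rewrite lee_fin powR_ge0.
  - rewrite (int0 false) mule_ge0 ?lee_fin ?(ltW c0)// mule_ge0 ?poweR_ge0//.
    by apply: integral_ge0 => z _; rewrite lee_fin powR_ge0.
have fN0 : 0 < fine N by rewrite lt_neqAle eq_sym N_neq0 fine_ge0.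
have N20 : 0 < 2 * fine N by rewrite mulr_gt0.
have NN : fine N < 2 * fine N by lra.
have [cR oscR] := oscN _ NN x t L L0 (@subset_refl _ _).
exists cR; rewrite !signed_pos !signed_neg.
have main up := @half_rect_reverse_holder R n p gamma alpha q r K (2 * fine N) M up x t L cR f
  p_gt1 gamma_ge0 gamma_lt_alpha alpha_lt1 q_gt0 q_le_r L0 Mgap K0 N20.
have cE : (2 `^ (r - q) + 3 `^ r * (2 * C1) * 2) * (K * (2 * fine N)) `^ (r - q) =
    c * fine N `^ (r - q).
  have K20 : 0 <= K * 2 by apply: mulr_ge0 => //; exact: ltW.
  have -> : K * (2 * fine N) = K * 2 * fine N by rewrite mulrA.
  by rewrite (powRM _ K20 (ltW fN0)) /c mulrA.
have rhs_le I J : (I <= ((2 `^ (r - q) + 3 `^ r * (2 * C1) * 2)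
      * (K * (2 * fine N)) `^ (r - q))%:E * J ->
    I <= c%:E * (N `^ (r - q) * J))%E.
  by rewrite cE NE poweR_EFin muleA -EFinM.
by split; apply: rhs_le; [apply: (main true)|apply: (main false)]; rewrite ?K2//; exact: oscN.
Qed.
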